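(* Fix $n\in\mathbb{N}^+$. The following problem is decidable: given $\langle b,w\rangle$ with $b\in W_n$ and $w\in\mathbb{N}$, decide whether there exists an SCA representation of $[b]\in B_n$ of width at most $w$.
   Context: **Braids.** $W_n$ is the set of finite words in the symbols $\sigma_1^{\pm1},\dots,\sigma_{n-1}^{\pm1}$ ($1$ is the empty word). The braid group $B_n$ is the quotient of $W_n$ by the relations $\sigma_i\sigma_i^{-1}=\sigma_i^{-1}\sigma_i=1$, $\sigma_i\sigma_j=\sigma_j\sigma_i$ for $|i-j|>1$, and $\sigma_i\sigma_{i+1}\sigma_i=\sigma_{i+1}\sigma_i\sigma_{i+1}$; $[b]$ is the class of $b$. **Cells.** A cell occupies two adjacent integer positions $(j,j+1)$ and is in one of eight states: $[N_j,N_{j+1}]$ (empty); $[s_j^{(i)},N_{j+1}]$, $[N_j,s_{j+1}^{(i)}]$, $[r_j^{(i)},N_{j+1}]$, $[N_j,l_{j+1}^{(i)}]$ (one strand); $[s_j^{(t)},s_{j+1}^{(t+1)}]$ (two straight strands); $[r_j^{(t)},l_{j+1}^{(t+1)}]$ (crossing of kind $T_1$, strand $t$ over strand $t+1$); $\overline{[r_j^{(t)},l_{j+1}^{(t+1)}]}$ (crossing of kind $T_2$, strand $t+1$ over strand $t$). Superscripts are strand numbers and the subscript is the position at which the strand enters. A strand marked $s$ (straight) leaves at the position where it enters, $r$ goes from $j$ to $j+1$, and $l$ goes from $j+1$ to $j$; strands marked $r$ or $l$ are said to turn. **Grid patterns.** An $n$-strand generation is a row of cells tiling the integer positions, all left positions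 having the same parity, containing exactly $n$ strands numbered $1,\dots,n$ from left to right. Its width is the number of cells from the cell containing strand $1$ to the cell containing strand $n$, inclusive. A grid pattern on $n$ strands is a finite or infinite list of $n$-strand generations (drawn upwards); $G_n$ is the set of these and $G_n^*$ the set of finite ones (including the empty list $[\,]$). A pattern has width at most $w$ if each of its generations has width at most $w$. **Continuity and rules.** For adjacent cells $A$ at $(j,j+1)$, $B$ at $(j+2,j+3)$ of a generation, their child is the cell at $(j+1,j+2)$ of the next generation. $A$ sends a strand to the child if a strand leaves $A$ at $j+1$; $B$ does if a strand leaves $B$ at $j+2$. A grid pattern is continuous if the cells of each non-first generation are the children of adjacent pairs of the previous one and, for every adjacent pair $A,B$ (empty cells included) of a non-last generation, the left (right) position of the child is occupied iff $A$ (respectively $B$) sends a strand to it. A turning rule is a function $\tau:\{S,T,N\}^2\to\{S,T\}$ (the value at $(N,N)$ being irrelevant); it is a turning rule of a continuous pattern if for each adjacent pair $A,B$ with nonempty child the strands of the child are straight when $\tau(a,b)=S$ and all turn when $\tau(a,b)=T$, where $a$ (resp. $b$) is $N$, $S$ or $T$ according as $A$ (resp. $B$) sends no strand, a straight strand, or a turning strand to the child. A crossing rule is a function $\kappa:\{T_1,T_2,0\}^2\to\{T_1,T_2\}$; it is a crossing rule of the pattern if each child that is a crossing has kind $\kappa(a',b')$, where $a'$ (resp. $b'$) is the kind of crossing in $A$ (resp. $B$), or $0$ if there is none. An SCA pattern is a continuous grid pattern having at least one turning rule and at least one crossing rule; $S_n\subseteq G_n$ and $S_n^*\subseteq G_n^*$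 are the sets of SCA patterns. **Representations.** $\psi:G_n^*\to W_n$ reads the cells of $g$ generation by generation (first to last) and left to right within a generation, replacing $[r_j^{(t)},l_{j+1}^{(t+1)}]$ by $\sigma_t$, $\overline{[r_j^{(t)},l_{j+1}^{(t+1)}]}$ by $\sigma_t^{-1}$, and every other cell by the empty word; $\varphi(g)=[\psi(g)]\in B_n$. An SCA representation of a braid $\beta\in B_n$ is a $g\in S_n^*$ with $\varphi(g)=\beta$. *)

(* Defs.v *)
From HB Require Import structures.
From mathcomp Require Import all_boot all_order all_algebra.
From mathcomp Require Import boolp.

Set Implicit Arguments.
Unset Strict Implicit.
Unset Printing Implicit Defensive.

Import GRing.Theory.

(** ** Recursive functions and decidability *)

(* The total recursive functions of Kleene: primitive recursion, and
   minimization of those [g] for which a zero always exists (so that no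
   partial functions are needed; by the normal form theorem these are exactly
   the total computable functions). *)
Inductive recursive : forall k, (k.-tuple nat -> nat) -> Prop :=
| rec_zero k : recursive (fun _ : k.-tuple nat => 0)
| rec_succ : recursive (fun v : 1.-tuple nat => (thead v).+1)
| rec_proj k (i : 'I_k) : recursive (fun v : k.-tuple nat => tnth v i)
| rec_comp k m (f : m.-tuple nat -> nat) (g : 'I_m -> k.-tuple nat -> nat) :
    recursive f -> (forall i, recursive (g i)) ->
    recursive (fun v : k.-tuple nat => f [tuple g i v | i < m])
| rec_prec k (f : k.-tuple nat -> nat) (g : k.+2.-tuple nat -> nat)
    (h : k.+1.-tuple nat -> nat) :
    recursive f -> recursive g ->
    (forall v : k.-tuple nat, h [tuple of 0 :: v] = f v) ->
    (forall (x : nat) (v : k.-tuple nat),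
       h [tuple of x.+1 :: v] = g [tuple of x :: h [tuple of x :: v] :: v]) ->
    recursive h
| rec_mu k (g : k.+1.-tuple nat -> nat) (f : k.-tuple nat -> nat) :
    recursive g ->
    (forall v : k.-tuple nat,
       g [tuple of f v :: v] = 0 /\
       forall y, y < f v -> g [tuple of y :: v] <> 0) ->
    recursive f.

Definition recursively_decidable (I : Type) (k : nat)
    (code : I -> k.-tuple nat) (P : I -> Prop) : Prop :=
  exists2 chi : k.-tuple nat -> nat, recursive chi &
    forall x, (P x -> chi (code x) = 1) /\ (~ P x -> chi (code x) = 0).

(** ** Braids *)

(* Generators and strands are numbered from 0 here: [(i, true)] is
   sigma_{i+1}, [(i, false)] is its inverse, and strand [i] is strand i+1. *)
Definition letter (n : nat) : Type := ('I_n.-1 * bool)%type.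
Definition word (n : nat) : Type := seq (letter n).

Definition sigma n (i : 'I_n.-1) : letter n := (i, true).

Inductive braid_eq n : word n -> word n -> Prop :=
| braid_inv (i : 'I_n.-1) (e : bool) : braid_eq [:: (i, e); (i, ~~ e)] [::]
| braid_comm (i j : 'I_n.-1) : (i.+1 < j) || (j.+1 < i) ->
    braid_eq [:: sigma i; sigma j] [:: sigma j; sigma i]
| braid_braid (i j : 'I_n.-1) : j = i.+1 :> nat ->
    braid_eq [:: sigma i; sigma j; sigma i] [:: sigma j; sigma i; sigma j]
| braid_refl b : braid_eq b b
| braid_sym b c : braid_eq b c -> braid_eq c b
| braid_trans b c d : braid_eq b c -> braid_eq c d -> braid_eq b d
| braid_cat b b' c c' :
    braid_eq b b' -> braid_eq c c' -> braid_eq (b ++ c) (b' ++ c').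

Definition braid_eqb n : rel (word n) := fun b c => `[< braid_eq b c >].

Lemma braid_eqb_refl n : reflexive (@braid_eqb n).
Proof. by move=> b; apply/asboolP; exact: braid_refl. Qed.

Lemma braid_eqb_sym n : symmetric (@braid_eqb n).
Proof. by move=> b c; apply/asboolP/asboolP; exact: braid_sym. Qed.

Lemma braid_eqb_trans n : transitive (@braid_eqb n).
Proof.
move=> c b d /asboolP bc /asboolP cd; apply/asboolP; exact: braid_trans bc cd.
Qed.

Canonical braid_equiv n : equiv_rel (word n) :=
  EquivRel (@braid_eqb n) (@braid_eqb_refl n) (@braid_eqb_sym n)
           (@braid_eqb_trans n).

Definition braid_group (n : nat) := {eq_quot (braid_equiv n)}%qT.

Definition braid_class n (b : word n) : braid_group n :=
  (\pi_({eq_quot (braid_equiv n)}) b)%qT.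

Lemma braid_classP n (b c : word n) :
  braid_class b = braid_class c <-> braid_eq b c.
Proof.
by split=> [/eqmodP/asboolP|bc] //; apply/eqmodP; apply/asboolP.
Qed.

Definition letter_code n (x : letter n) : nat := (x.1).*2 + x.2.
Definition word_code n (b : word n) : nat := CodeSeq.code (map (@letter_code n) b).

Lemma word_code_inj n : injective (@word_code n).
Proof.
apply: inj_comp; first exact: can_inj CodeSeq.codeK.
apply: inj_map => -[i d] [j e]; rewrite /letter_code /= => eq_c.
have eq_b : d = e.
  by move/(congr1 odd): eq_c; rewrite !oddD !odd_double !oddb.
move: eq_c; rewrite eq_b => /addIn/double_inj eq_ij.
by rewrite (val_inj eq_ij).
Qed.

Definition instance_code n (x : word n * nat) : 2.-tuple nat :=
  [tuple word_code x.1; x.2].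

(** ** Cells *)

Inductive crossing_kind : Type := T1 | T2.
Inductive direction : Type := Straight | Turn.

(* The two letters of a constructor are the states of the left and the right
   position of the cell; the positions themselves are recorded by the
   generation.  [SS t] and [RL k t] contain the strands [t] and [t.+1]. *)
Inductive cell (n : nat) : Type :=
| NN
| SN of 'I_n
| RN of 'I_n
| NS of 'I_n
| NL of 'I_n
| SS of 'I_n.-1
| RL of crossing_kind & 'I_n.-1.
Arguments NN {n}.

Definition strands n (c : cell n) : seq nat :=
  match c with
  | NN => [::]
  | SN i | RN i | NS i | NL i => [:: nat_of_ord i]
  | SS t | RL _ t => [:: nat_of_ord t; t.+1]
  end.

Definition nonempty n (c : cell n) : bool := strands c != [::].

Definition left_occupied n (c : cell n) : bool :=
  match c with SN _ | RN _ | SS _ | RL _ _ => true | _ => false end.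

Definition right_occupied n (c : cell n) : bool :=
  match c with NS _ | NL _ | SS _ | RL _ _ => true | _ => false end.

(* The strand, if any, that leaves the cell at its left (right) position. *)
Definition left_exit n (c : cell n) : option direction :=
  match c with
  | SN _ | SS _ => Some Straight
  | NL _ | RL _ _ => Some Turn
  | _ => None
  end.

Definition right_exit n (c : cell n) : option direction :=
  match c with
  | NS _ | SS _ => Some Straight
  | RN _ | RL _ _ => Some Turn
  | _ => None
  end.

Definition cell_direction n (c : cell n) : option direction :=
  match c with
  | NN => None
  | SN _ | NS _ | SS _ => Some Straight
  | RN _ | NL _ | RL _ _ => Some Turn
  end.

Definition cell_kind n (c : cell n) : option crossing_kind :=
  if c is RL k _ then Some k else None.

(** ** Grid patterns *)

(* A row tiling the integers is recorded by its segment from the cell of the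
   first strand to the cell of the last one (see [is_generation]); [start] is
   the left position of the first cell of the segment.  All cells outside the
   segment are empty. *)
Record generation (n : nat) := Generation {
  start : int;
  cells : seq (cell n)
}.

Definition is_generation n (g : generation n) : bool :=
  [&& flatten (map (@strands n) (cells g)) == iota 0 n,
      nonempty (head NN (cells g)) & nonempty (last NN (cells g))].

Definition width n (g : generation n) : nat := size (cells g).

(* The [k]-th cell of the row, and its left position, for [k] in Z. *)
Definition cell_at n (g : generation n) (k : int) : cell n :=
  if k is Posz i then nth NN (cells g) i else NN.

Definition left_position n (g : generation n) (k : int) : int :=
  (start g + k *+ 2)%R.

Definition pattern (n : nat) : Type := seq (generation n).

Definition is_pattern n (p : pattern n) : bool := all (@is_generation n) p.

Definition width_at_most n (w : nat) (p : pattern n) : bool :=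
  all (fun g => width g <= w) p.

Definition consecutive n (p : pattern n) (g h : generation n) : Prop :=
  exists p1 p2 : pattern n, p = p1 ++ [:: g, h & p2].

(* [C] is the child of the adjacent cells [A] and [B]. *)
Definition child_of n (p : pattern n) (A B C : cell n) : Prop :=
  exists (g h : generation n) (k k' : int),
    [/\ consecutive p g h,
        left_position h k' = (left_position g k + 1)%R,
        A = cell_at g k, B = cell_at g (k + 1)%R & C = cell_at h k'].

Definition continuous n (p : pattern n) : Prop :=
  (forall g h, consecutive p g h -> forall k' : int,
     exists k : int, left_position h k' = (left_position g k + 1)%R) /\
  (forall A B C, child_of p A B C ->
     (left_occupied C <-> right_exit A <> None) /\
     (right_occupied C <-> left_exit B <> None)).

Definition is_turning_rule n
    (tau : option direction -> option direction -> direction)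
    (p : pattern n) : Prop :=
  forall A B C, child_of p A B C -> nonempty C ->
    cell_direction C = Some (tau (right_exit A) (left_exit B)).

Definition is_crossing_rule n
    (kappa : option crossing_kind -> option crossing_kind -> crossing_kind)
    (p : pattern n) : Prop :=
  forall A B C, child_of p A B C -> forall k, cell_kind C = Some k ->
    k = kappa (cell_kind A) (cell_kind B).

Definition is_SCA_pattern n (p : pattern n) : Prop :=
  [/\ is_pattern p, continuous p,
      exists tau, is_turning_rule tau p & exists kappa, is_crossing_rule kappa p].

(** ** Representations *)

Definition cell_word n (c : cell n) : word n :=
  match c with
  | RL T1 t => [:: (t, true)]
  | RL T2 t => [:: (t, false)]
  | _ => [::]
  end.

Definition psi n (p : pattern n) : word n :=
  flatten [seq flatten (map (@cell_word n) (cells g)) | g <- p].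

Definition phi n (p : pattern n) : braid_group n := braid_class (psi p).

Definition SCA_representation n (beta : braid_group n) (p : pattern n) : Prop :=
  is_SCA_pattern p /\ phi p = beta.

(* Main.v *)
From HB Require Import structures.
Require Import Defs.
From mathcomp Require Import all_boot all_algebra zify.
From mathcomp Require boolp.

Set Implicit Arguments.
Unset Strict Implicit.
Unset Printing Implicit Defensive.
Import GRing.Theory.

(** The turning and crossing rules of a pattern determine each row from the
    preceding one, up to translation, and the numbers of the strands are
    determined by their order.  So a pattern is an initial segment of the orbit
    of its first row under one of finitely many maps, and there are finitely
    many rows of width at most [w].  A pattern of width at most [w] that is
    longer than this number runs through a cycle, and its word is [u v^k x] with
    [u], [v] and [x] of bounded length.  Such a word represents [b] only if [v^k]
    represents [u^-1 b x^-1].  It is therefore enough to solve the word problem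
    and to bound the exponent of a power by the lengths of the words involved:
    then a search through the patterns of bounded length decides the problem.

    Both follow from combing.  The braids on [m + 2] strands that bring the last
    strand back to its place form a subgroup of index [m + 2], which is the
    semidirect product of the free group on the loops of the last strand around
    the others with the group of braids of the other strands; the latter acts on
    the former by Artin's automorphisms.  Reading a word letter by letter, [comb]
    computes its coset and its two components.  That the result depends on the
    braid alone is checked on the defining relations ([comb_beq_start]); that it
    determines the braid follows from the commutation of the generators with
    coset representatives and loops ([comb_word_val]).  By induction on the
    number of strands this solves the word problem ([braid_eq_testP]).

    For a power [v^k], replace [v] by a power of it that brings the last strand
    back to its place.  If the braid of the other strands has infinite order, [k] is
    bounded by induction.  Otherwise, for a further power of [v], that braid is
    trivial and the computation takes place in the free group, where the length of
    the [k]-th power of a nontrivial element is at least [k] after a conjugation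
    ([free_power_bound]).  The lengths of the components are at most exponential
    in the length of the word, which makes the bound explicit ([power_bound]).

    The search itself is shown to be recursive by composing functions on encoded
    data ([computable_search]).  Functions on finite types are given by tables,
    so only folds, iterations and arithmetic need constructions. *)

(** * Signed words and free reduction *)

Definition sletter := (nat * bool)%type.
Definition sword := seq sletter.

Definition inv_letter (x : sletter) : sletter := (x.1, ~~ x.2).
Definition inv_word (w : sword) : sword := rev (map inv_letter w).

Definition push (x : sletter) (r : sword) : sword :=
  if r is y :: r' then if y == inv_letter x then r' else x :: r else [:: x].

Definition red : sword -> sword := foldr push [::].

Definition reduced (w : sword) : bool :=
  sorted (fun x y => y != inv_letter x) w.

Definition pow (k : nat) (w : sword) : sword := flatten (nseq k w).

Lemma inv_letterK : involutive inv_letter.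
Proof. by case=> i e; rewrite /inv_letter /= negbK. Qed.

Lemma inv_letter_neq x : x != inv_letter x.
Proof. by case: x => i []; rewrite /inv_letter /= xpair_eqE andbF. Qed.

Lemma inv_wordK : involutive inv_word.
Proof.
by move=> w; rewrite /inv_word map_rev revK -map_comp map_id_in // => x _ /=;
  rewrite inv_letterK.
Qed.

Lemma inv_word_cat u v : inv_word (u ++ v) = inv_word v ++ inv_word u.
Proof. by rewrite /inv_word map_cat rev_cat. Qed.

Lemma size_inv_word w : size (inv_word w) = size w.
Proof. by rewrite /inv_word size_rev size_map. Qed.

Lemma powS k w : pow k.+1 w = w ++ pow k w.
Proof. by []. Qed.

Lemma powD j k w : pow (j + k) w = pow j w ++ pow k w.
Proof. by elim: j => //= j IH; rewrite addSn !powS IH catA. Qed.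

Lemma powSr k w : pow k.+1 w = pow k w ++ w.
Proof. by rewrite -addn1 powD /pow /= cats0. Qed.

Lemma powM j k w : pow (j * k) w = pow k (pow j w).
Proof. by elim: k => [|k IH]; rewrite ?muln0 // mulnS powD IH. Qed.

Lemma size_pow k w : size (pow k w) = k * size w.
Proof. by elim: k => //= k IH; rewrite powS size_cat IH mulSn. Qed.

Lemma push_reduced x r : reduced r -> reduced (push x r).
Proof.
case: r => //= y r; case: eqVneq => [_|nyx] /=; first by case: r => //= z r /andP[].
by rewrite nyx.
Qed.

Lemma red_reduced w : reduced (red w).
Proof. by elim: w => //= x w IH; exact: push_reduced. Qed.

Lemma reduced_push x w : reduced (x :: w) -> push x w = x :: w.
Proof. by case: w => //= y w /andP[/negPf->]. Qed.

Lemma reduced_behead x w : reduced (x :: w) -> reduced w.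
Proof. by case: w => //= y w /andP[]. Qed.

Lemma red_id w : reduced w -> red w = w.
Proof.
elim: w => //= x w IH rw.
by rewrite (IH (reduced_behead rw)) reduced_push.
Qed.

Lemma pushK x r : reduced r -> push x (push (inv_letter x) r) = r.
Proof.
case: r => [|y r] rr /=; first by rewrite eqxx.
rewrite inv_letterK; case: eqVneq rr => [->|_ _] /=; last by rewrite eqxx.
exact: reduced_push.
Qed.

Lemma foldr_push_red u r : reduced r -> foldr push r (red u) = foldr push r u.
Proof.
move=> rr; elim: u => //= x u IH; rewrite -IH.
case: (red u) => //= y v; case: eqP => // ->; rewrite pushK //.
by elim: v => //= z v; exact: push_reduced.
Qed.

Lemma red_catl u v : red (red u ++ v) = red (u ++ v).
Proof. by rewrite /red !foldr_cat foldr_push_red // red_reduced. Qed.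

Lemma red_catr u v : red (u ++ red v) = red (u ++ v).
Proof. by rewrite /red !foldr_cat -/red (red_id (red_reduced v)). Qed.

Lemma red_cat u u' v v' :
  red u = red u' -> red v = red v' -> red (u ++ v) = red (u' ++ v').
Proof.
by move=> eu ev; rewrite -red_catl eu red_catl -red_catr ev red_catr.
Qed.

Lemma red_invr u : red (u ++ inv_word u) = [::].
Proof.
elim: u => // x u IH; rewrite /inv_word /= rev_cons -cats1 -/(inv_word u) catA.
rewrite -[push _ _]/(red ([:: x] ++ _)) -red_catr -[RHS]/(red [::]).
have -> : red ((u ++ inv_word u) ++ [:: inv_letter x]) = [:: inv_letter x].
  by rewrite -red_catl IH.
by rewrite /= eqxx.
Qed.

Lemma red_cancelr u v : red (u ++ inv_word u ++ v) = red v.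
Proof. by rewrite catA -red_catl red_invr. Qed.

Lemma red_cancell u v : red (inv_word u ++ u ++ v) = red v.
Proof. by rewrite -{2}(inv_wordK u) red_cancelr. Qed.

Lemma size_red w : size (red w) <= size w.
Proof.
elim: w => //= x w IH; case: (red w) IH => //= y r; case: eqP => _ /=; lia.
Qed.

(** Conjugating away matching ends shows that a reduced word is a conjugate of
    a word [c] all of whose powers are reduced. *)
Lemma cyclic_reduction f : reduced f -> f != [::] ->
  exists g c, [/\ f = g ++ c ++ inv_word g, c != [::] & reduced (c ++ c)].
Proof.
have [k] := ubnP (size f); elim: k f => // k IH [//|x s] /= le_k rf _.
case/lastP: s rf le_k => [|s y] rf le_k.
  exists [::], [:: x]; split=> //=; by rewrite inv_letter_neq.
case: (eqVneq y (inv_letter x)) => [yx|nyx]; last first.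
  exists [::], (x :: rcons s y); split=> //=; first by rewrite cats0.
  move: rf; rewrite /reduced /= cat_path => rf.
  rewrite rf last_rcons /= rf andbT.
  by apply: contraNneq nyx => ->; rewrite inv_letterK.
have rs : reduced s.
  by move: (reduced_behead rf); rewrite /reduced -cats1 => /cat_sorted2[].
case: (altP (s =P [::])) => [s0|s0].
  by move: rf; rewrite s0 yx /= eqxx.
have sk : size s < k by move: le_k; rewrite size_rcons; lia.
have [g [c [-> c0 rc]]] := IH s sk rs s0.
exists (x :: g), c; split=> //=.
by rewrite yx /inv_word /= rev_cons -!cats1 !catA.
Qed.

(** Whether a power is reduced is visible at the junction of two factors. *)
Lemma pow_reduced c k : reduced (c ++ c) -> reduced (pow k c).
Proof.
move=> rcc; have rc : reduced c by case/cat_sorted2: rcc.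
case: k => // k; elim: k => [|k IH]; first by rewrite /pow /= cats0.
move: rcc rc IH; rewrite [pow k.+2 c]powS; case: c => // x s.
rewrite powS /reduced /= => rcc _ IH.
by move: rcc; rewrite cat_path [in X in _ -> X]cat_path /= IH => /and3P[-> ->].
Qed.

(** After a conjugation, the [k]-th power of a nontrivial element is a reduced
    word of [k] equal nonempty factors; the conjugating word is at most half as
    long as [f]. *)
Lemma free_power_bound f a k :
  red f != [::] -> red (pow k f) = red a -> k <= size a + size f.
Proof.
move=> f0 eq_fa.
have [g [c [ef c0 rcc]]] := cyclic_reduction (red_reduced f) f0.
have conj j : red (pow j f) = red (g ++ pow j c ++ inv_word g).
  elim: j => [|j IH]; first by rewrite red_invr.
  rewrite !powS -red_catr IH red_catr -red_catl ef -!catA.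
  by apply: red_cat => //; apply: red_cat => //; rewrite red_cancell.
have size_c : 0 < size c by rewrite lt0n size_eq0.
have eq_c : red (inv_word g ++ a ++ g) = pow k c.
  rewrite -(red_id (pow_reduced k rcc)).
  transitivity (red (inv_word g ++ (g ++ pow k c ++ inv_word g) ++ g)).
    by apply: red_cat => //; apply: red_cat => //; rewrite -eq_fa conj.
  rewrite -!catA red_cancell -[in RHS](cats0 (pow k c)); apply: red_cat => //.
  by rewrite -[X in _ ++ X]cats0 red_cancell.
have := size_red (inv_word g ++ a ++ g); rewrite eq_c size_pow !size_cat.
have := size_red f; rewrite ef !size_cat !size_inv_word.
have := leq_pmulr k size_c; lia.
Qed.

(** * Artin's action and the combing of a braid *)

(** The number of generators is not bounded here, so that one relation compares
    braids on all numbers of strands. *)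
Inductive beq : sword -> sword -> Prop :=
| beq_inv i e : beq [:: (i, e); (i, ~~ e)] [::]
| beq_comm i j : i.+1 < j ->
    beq [:: (i, true); (j, true)] [:: (j, true); (i, true)]
| beq_braid i :
    beq [:: (i, true); (i.+1, true); (i, true)]
        [:: (i.+1, true); (i, true); (i.+1, true)]
| beq_refl b : beq b b
| beq_sym b c : beq b c -> beq c b
| beq_trans b c d : beq b c -> beq c d -> beq b d
| beq_cat b b' c c' : beq b b' -> beq c c' -> beq (b ++ c) (b' ++ c').

(** Artin's automorphism for the generator [s_k], which sends the free generator
    [a_k] to [a_(k+1)] and [a_(k+1)] to [a_(k+1)^-1 a_k a_(k+1)], and its inverse. *)
Definition act_letter (x y : sletter) : sword :=
  let: (k, e) := x in let: (i, d) := y in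
  if i == k then
    if e then [:: (k.+1, d)] else [:: (k, true); (k.+1, d); (k, false)]
  else if i == k.+1 then
    if e then [:: (k.+1, false); (k, d); (k.+1, true)] else [:: (k, d)]
  else [:: y].

Definition extend (h : sletter -> sword) (u : sword) : sword :=
  flatten (map h u).

Definition act_word (x : sletter) : sword -> sword := extend (act_letter x).

Definition act (b u : sword) : sword := foldr act_word u b.

Lemma extend_cat h u v : extend h (u ++ v) = extend h u ++ extend h v.
Proof. by rewrite /extend map_cat flatten_cat. Qed.

Section Extend.
Variable h : sletter -> sword.
Hypothesis h_inv : forall x, h (inv_letter x) = inv_word (h x).

Lemma red_extend_red u : red (extend h (red u)) = red (extend h u).
Proof.
elim: u => //= x u IH; rewrite -[extend h (x :: u)]/(h x ++ extend h u).
rewrite -[in RHS]red_catr -IH red_catr.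
case: (red u) => //= y r; case: eqP => // ->.
by rewrite -[extend h (_ :: r)]/(h _ ++ extend h r) h_inv red_cancelr.
Qed.

Lemma red_extend u v : red u = red v -> red (extend h u) = red (extend h v).
Proof. by move=> e; rewrite -red_extend_red e red_extend_red. Qed.
End Extend.

Lemma eq_red_extend h h' u : (forall x, red (h x) = red (h' x)) ->
  red (extend h u) = red (extend h' u).
Proof.
move=> e; elim: u => // x u IH.
by rewrite -[extend h _]/(h x ++ extend h u); exact: red_cat.
Qed.

Lemma act_letter_inv x y :
  act_letter x (inv_letter y) = inv_word (act_letter x y).
Proof.
by case: x y => [k e] [i d]; rewrite /act_letter /=; case: eqP => _;
  [| case: eqP => _]; case: e.
Qed.

Lemma act_cat b u v : act b (u ++ v) = act b u ++ act b v.
Proof. by elim: b => //= x b ->; rewrite /act_word extend_cat. Qed.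

Lemma act_comp b c u : act (b ++ c) u = act b (act c u).
Proof. exact: foldr_cat. Qed.

Lemma act_nil b : act b [::] = [::].
Proof. by elim: b => //= x b ->. Qed.

Lemma red_act b u v : red u = red v -> red (act b u) = red (act b v).
Proof.
by move=> e; elim: b => //= x b IH; exact: (red_extend (@act_letter_inv x)).
Qed.

Lemma act_extend b u : act b u = extend (fun x => act b [:: x]) u.
Proof.
by elim: u => [|x u IH]; rewrite ?act_nil // -cat1s act_cat extend_cat IH /extend /= cats0.
Qed.

Lemma red_act_letters b c u :
  (forall x, red (act b [:: x]) = red (act c [:: x])) ->
  red (act b u) = red (act c u).
Proof. by move=> e; rewrite act_extend [act c u]act_extend; exact: eq_red_extend. Qed.

(* Evaluates words with symbolic indices up to undecided comparisons. *)
Ltac compute_indices :=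
  repeat progress rewrite /inv_letter /= ?xpair_eqE ?eqxx ?andbT ?andbF /=.

(* Splits on the comparisons of generator indices that block a computation. *)
Ltac decide_indices :=
  compute_indices;
  repeat (match goal with
    | |- context [@eq_op ?T ?a ?b] => unify (Equality.sort T) nat;
        case: (@eqVneq T a b) => ?; try (exfalso; lia)
    end; compute_indices).

(** Artin's automorphisms satisfy the braid relations: as they are homomorphisms
    of the free group, it is enough to compare them on one letter. *)
Lemma red_act_beq b c u : beq b c -> red (act b u) = red (act c u).
Proof.
move=> bc; elim: bc u => {b c}
  [i e|i j ij|i|//|b c _ IH|b c d _ IH1 _ IH2|b b' c c' _ IH1 _ IH2] u.
1-3: apply: red_act_letters => -[k d]; rewrite /act /= /act_word /extend /=.
- by case: d; case: e; decide_indices; subst; decide_indices; rewrite ?cats0.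
- by case: d; decide_indices; subst; decide_indices; rewrite ?cats0.
- by case: d; decide_indices; subst; decide_indices; rewrite ?cats0.
- by rewrite IH.
- by rewrite IH1.
- by rewrite !act_comp IH1; apply: red_act; exact: IH2.
Qed.

(** With generators [s_0], ..., [s_(m-1)], a state [(f, b, j)] stands for the
    braid [f b s_(m-1) ... s_j].  Here [f] is a word in the loops [a_i] of the
    last strand around strand [i], and [b] only involves the other strands. *)
Definition comb_state := (sword * sword * nat)%type.

(** Right multiplication of the coset representative [s_(m-1) ... s_j] by a
    letter changes the coset if the letter is [s_j] or [s_(j-1)], at the cost of
    a loop in two of the four cases, which has to be moved to the left of [b].
    All other generators pass through the representative, and those with index
    above [j] are shifted down. *)
Definition comb_step (st : comb_state) (x : sletter) : comb_state :=
  let: (f, b, j) := st in let: (i, e) := x in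
  if i == j then (if e then f ++ act b [:: (j, true)] else f, b, j.+1)
  else if i.+1 == j then (if e then f else f ++ act b [:: (i, false)], b, i)
  else (f, b ++ [:: (if j < i then i.-1 else i, e)], j).

Definition comb : comb_state -> sword -> comb_state := foldl comb_step.

(** Left multiplication by [f b] in the semidirect product. *)
Definition comb_mul (f b : sword) (st : comb_state) : comb_state :=
  let: (f', b', j') := st in (f ++ act b f', b ++ b', j').

Lemma comb_step_mul f b st x :
  comb_step (comb_mul f b st) x = comb_mul f b (comb_step st x).
Proof.
case: st x => [[f' b'] j'] [i e] /=.
by case: eqP => _; [|case: eqP => _]; case: e => /=;
  rewrite ?act_cat ?act_comp ?catA.
Qed.

Lemma comb_mulE f b st w : comb (comb_mul f b st) w = comb_mul f b (comb st w).
Proof.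
by rewrite /comb; elim: w st => //= x w IH st; rewrite comb_step_mul IH.
Qed.

Lemma comb_start f b j w : comb (f, b, j) w = comb_mul f b (comb ([::], [::], j) w).
Proof. by rewrite -comb_mulE /= act_nil !cats0. Qed.

Lemma comb_cat st u v : comb st (u ++ v) = comb (comb st u) v.
Proof. exact: foldl_cat. Qed.

Definition comb_eq (s t : comb_state) : Prop :=
  [/\ red s.1.1 = red t.1.1, beq s.1.2 t.1.2 & s.2 = t.2].

Lemma comb_eq_refl s : comb_eq s s.
Proof. by split=> //; exact: beq_refl. Qed.

Lemma comb_eq_trans s t u : comb_eq s t -> comb_eq t u -> comb_eq s u.
Proof.
move=> [e1 e2 e3] [e4 e5 e6]; split; [by rewrite e1|exact: beq_trans e5|].
by rewrite e3.
Qed.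

Lemma comb_eq_sym s t : comb_eq s t -> comb_eq t s.
Proof. by move=> [e1 e2 e3]; split=> //; exact: beq_sym. Qed.

Lemma comb_eq_mul f f' b b' s t : red f = red f' -> beq b b' -> comb_eq s t ->
  comb_eq (comb_mul f b s) (comb_mul f' b' t).
Proof.
case: s t => [[f1 b1] j1] [[f2 b2] j2] ef eb [/= e1 e2 <-]; split=> //=.
  by apply: red_cat => //; rewrite (red_act_beq _ eb); exact: red_act.
exact: beq_cat.
Qed.

Ltac decide_positions :=
  compute_indices;
  repeat (match goal with
    | |- context [@eq_op ?T ?a ?b] => unify (Equality.sort T) nat;
        case: (@eqVneq T a b) => ?; try (exfalso; lia)
    | |- context [leq ?a ?b] => case: (leqP a b) => ?; try (exfalso; lia)
    end; compute_indices).

(** Right multiplication by generators of the cosets of the stabilizer of the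
    last strand respects the braid relations: on each coset both sides of a
    relation give the same element of the semidirect product. *)
Lemma comb_beq_start b c j : beq b c ->
  comb_eq (comb ([::], [::], j) b) (comb ([::], [::], j) c).
Proof.
move=> bc; elim: bc j => {b c}
  [i e|i k ik|i|b|b c _ IH|b c d _ IH1 _ IH2|b b' c c' _ IH1 _ IH2] j.
- case: e; rewrite /comb /=; decide_positions;
    split=> //=; try lia; try exact: beq_refl; try exact: (beq_inv _ true);
     try exact: (beq_inv _ false); subst; compute_indices => //.
- rewrite /comb /=; decide_positions;
    (split=> //=; try lia; try exact: beq_refl; try (apply: beq_comm; lia);
     subst; rewrite /act /act_word /extend /=; decide_indices => //).
- rewrite /comb /=; decide_positions;
    (split=> //=; try lia; try exact: beq_refl; try exact: beq_braid;
     subst; rewrite /act /act_word /extend /=; decide_indices => //).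
  (* The coset is left of both generators, which are then shifted down. *)
  have -> : i = i.-1.+1 by lia.
  exact: beq_braid.
- exact: comb_eq_refl.
- exact: comb_eq_sym.
- exact: comb_eq_trans (IH1 j) (IH2 j).
- rewrite !comb_cat; have := IH1 j.
  case: (comb _ b) (comb _ b') => [[f g] k] [[f' g'] k'] [/= e1 e2 <-].
  by rewrite [comb (f, _, _) _]comb_start [comb (f', _, _) _]comb_start;
    exact: comb_eq_mul.
Qed.

Definition bounded (m : nat) (w : sword) : bool := all (fun x => x.1 < m) w.

Lemma bounded_cat m u v : bounded m (u ++ v) = bounded m u && bounded m v.
Proof. exact: all_cat. Qed.

Lemma bounded_inv m w : bounded m (inv_word w) = bounded m w.
Proof. by rewrite /bounded /inv_word all_rev all_map. Qed.

Lemma bounded_pow m k w : bounded m w -> bounded m (pow k w).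
Proof. by move=> bw; elim: k => // k IH; rewrite powS bounded_cat bw. Qed.

Lemma bounded_act_word m x u :
  x.1 < m -> bounded m.+1 u -> bounded m.+1 (act_word x u).
Proof.
case: x => k e /= km; elim: u => //= -[i d] u IH /andP[/= im /IH bu].
rewrite -[act_word _ _]/(act_letter (k, e) (i, d) ++ act_word (k, e) u) bounded_cat bu andbT.
rewrite /act_letter /=; case: eqP => _; [|case: eqP => _]; case: e {bu IH};
  by rewrite /= ?andbT; lia.
Qed.

Lemma bounded_act m b u :
  bounded m b -> bounded m.+1 u -> bounded m.+1 (act b u).
Proof. by move=> + bu; elim: b => //= x b IH /andP[xm /IH]; exact: bounded_act_word. Qed.

Definition comb_bounded m (st : comb_state) : bool :=
  [&& bounded m.+1 st.1.1, bounded m st.1.2 & st.2 <= m.+1].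

Lemma comb_step_bounded m st x :
  x.1 < m.+1 -> comb_bounded m st -> comb_bounded m (comb_step st x).
Proof.
case: st x => [[f b] j] [i e] /= im /and3P[/= bf bb jm].
rewrite /comb_bounded; case: (eqVneq i j) => [ij|nij].
  rewrite /= bb -ij im !andbT; case: e => //.
  by rewrite bounded_cat bf /= bounded_act //= im.
case: (eqVneq i.+1 j) => [ij|nij1] /=.
  rewrite bb (ltnW im) !andbT; case: e => //.
  by rewrite bounded_cat bf /= bounded_act //= im.
by rewrite bf jm bounded_cat bb /= !andbT; case: ifP => /= ji; lia.
Qed.

Lemma comb_bounded_comb m st w :
  bounded m.+1 w -> comb_bounded m st -> comb_bounded m (comb st w).
Proof.
elim: w st => //= x w IH st /andP[xm bw] bst.
by apply: IH => //; exact: comb_step_bounded.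
Qed.

Lemma comb_size_braid st w : size (comb st w).1.2 <= size st.1.2 + size w.
Proof.
elim: w st => [|x w IH] st /=; first by rewrite addn0.
apply: leq_trans (IH _) _.
case: st x => [[f b] j] [i e] /=; case: eqP => _; [|case: eqP => _] => /=;
  rewrite ?size_cat /=; lia.
Qed.

Lemma size_extend h c u : (forall x, size (h x) <= c) ->
  size (extend h u) <= c * size u.
Proof.
move=> hc; elim: u => // x u IH; rewrite -[extend h _]/(h x ++ extend h u).
by rewrite size_cat /= mulnS leq_add.
Qed.

Lemma size_act b u : size (act b u) <= 3 ^ size b * size u.
Proof.
elim: b => /= [|x b IH]; first by rewrite mul1n.
rewrite expnS -mulnA; apply: leq_trans (@size_extend _ 3 _ _) _.
  by case: x => k e [i d]; rewrite /act_letter; case: eqP => _;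
    [|case: eqP => _]; case: e.
by rewrite leq_mul2l IH orbT.
Qed.

(** A loop is moved past the braid read so far, and each letter of this braid at
    most triples the length. *)
Lemma comb_size_free st w :
  size (comb st w).1.1 <= size st.1.1 + size w * 3 ^ (size st.1.2 + size w).
Proof.
elim: w st => [|x w IH] st /=; first by rewrite mul0n addn0.
apply: leq_trans (IH _) _.
have hb : size (comb_step st x).1.2 <= size st.1.2 + 1.
  by have := comb_size_braid st [:: x].
have hf : size (comb_step st x).1.1 <= size st.1.1 + 3 ^ size st.1.2.
  case: st x {hb IH} => [[f b] j] [i e] /=; case: eqP => _; [|case: eqP => _] => /=;
    case: e; rewrite ?size_cat ?leq_addr //= leq_add2l;
    by apply: leq_trans (size_act _ _) _; rewrite muln1.
have h1 : 3 ^ (size (comb_step st x).1.2 + size w) <= 3 ^ (size st.1.2 + (size w).+1).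
  by rewrite leq_exp2l; lia.
have h2 : 3 ^ size st.1.2 <= 3 ^ (size st.1.2 + (size w).+1).
  by rewrite leq_exp2l; lia.
have h3 := leq_mul (leqnn (size w)) h1.
rewrite mulSn; lia.
Qed.

Lemma comb_start_bounded m j w : j <= m.+1 -> bounded m.+1 w ->
  comb_bounded m (comb ([::], [::], j) w).
Proof. by move=> jm bw; apply: comb_bounded_comb; rewrite /comb_bounded. Qed.

(** The word problem: a word on the first [m] generators is trivial when its
    last strand returns to its place, winds trivially around the others, and
    the braid of the other strands is trivial. *)
Fixpoint trivialb (m : nat) (w : sword) : bool :=
  if m is m'.+1 then
    let: (f, b, j) := comb ([::], [::], m) w in
    [&& j == m, red f == [::] & trivialb m' b]
  else w == [::].

Lemma trivialb_beq m b c : bounded m b -> bounded m c -> beq b c ->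
  trivialb m b = trivialb m c.
Proof.
elim: m b c => [|m IH] b c bb bc eq_bc; first by case: b c bb bc {eq_bc} => [|x b] [|y c].
have h1 : comb_bounded m (comb ([::], [::], m.+1) b) by exact: comb_start_bounded.
have h2 : comb_bounded m (comb ([::], [::], m.+1) c) by exact: comb_start_bounded.
have := comb_beq_start m.+1 eq_bc; rewrite /=.
case: (comb _ b) (comb _ c) h1 h2 => [[f g] k] [[f' g'] k'].
by move=> /and3P[/= _ bg _] /and3P[/= _ bg' _] [/= -> /(IH _ _ bg bg')-> ->].
Qed.

Lemma trivialb_sound m w : bounded m w -> beq w [::] -> trivialb m w.
Proof.
move=> bw /(trivialb_beq bw) -> //; elim: m {w bw} => //= m ->.
by rewrite eqxx.
Qed.

(** * Completeness of combing *)

Section Evaluation.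
Variable G : groupType.
Local Open Scope group_scope.

Definition letter_val (a : nat -> G) (x : sletter) : G :=
  if x.2 then a x.1 else (a x.1)^-1.

Definition word_val (a : nat -> G) (w : sword) : G :=
  foldr (fun x g => letter_val a x * g) 1 w.

Lemma word_val1 a x : word_val a [:: x] = letter_val a x.
Proof. exact: mulg1. Qed.

Lemma word_val_cat a u v : word_val a (u ++ v) = word_val a u * word_val a v.
Proof. by elim: u => [|x u IH] /=; rewrite ?mul1g // IH mulgA. Qed.

Lemma letter_val_inv a x : letter_val a (inv_letter x) = (letter_val a x)^-1.
Proof. by case: x => i []; rewrite /letter_val //= invgK. Qed.

Lemma word_val_inv a u : word_val a (inv_word u) = (word_val a u)^-1.
Proof.
elim: u => [|x u IH]; first by rewrite /= invg1.
by rewrite -cat1s inv_word_cat !word_val_cat IH !word_val1 letter_val_inv invgM.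
Qed.

Lemma word_val_red a u : word_val a (red u) = word_val a u.
Proof.
elim: u => //= x u <-; case: (red u) => //= y r; case: eqP => // ->.
by rewrite letter_val_inv mulVKg.
Qed.

Lemma conj_slide (x c a b : G) : x * c = c * x -> x * a = b * x ->
  x * (c * a / c) = c * b / c * x.
Proof.
move=> xc xa; apply: (mulIg c).
by rewrite -!mulgA mulVg mulg1 xc mulKg mulgA xc -mulgA xa.
Qed.

Variables (m : nat) (s : nat -> G).
Hypothesis s_comm : forall i j, i.+1 < j -> j < m -> s i * s j = s j * s i.
Hypothesis s_braid : forall i, i.+1 < m ->
  s i * s i.+1 * s i = s i.+1 * s i * s i.+1.

(** The representative [s_(m-1) ... s_j] of a coset of the subgroup of braids
    that bring the last strand back to its place. *)
Definition coset_rep (j : nat) : G :=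
  word_val s (rev (map (fun i => (i, true)) (iota j (m - j)))).

Lemma coset_rep_last : coset_rep m = 1.
Proof. by rewrite /coset_rep subnn. Qed.

Lemma coset_repS j : j < m -> coset_rep j = coset_rep j.+1 * s j.
Proof.
move=> jm; rewrite /coset_rep (_ : m - j = (m - j.+1).+1)%N; last by lia.
by rewrite /= rev_cons -cats1 word_val_cat word_val1.
Qed.

Lemma coset_rep_comm j k : k.+1 < j -> j <= m ->
  s k * coset_rep j = coset_rep j * s k.
Proof.
move=> kj; have [d] := ubnP (m - j); elim: d j kj => // d IH j kj dm jm.
have [->|jm'] := eqVneq j m; first by rewrite coset_rep_last mulg1 mul1g.
rewrite coset_repS; last by lia.
rewrite mulgA IH ?(ltnW kj) //; try lia.
by rewrite -!mulgA s_comm //; lia.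
Qed.

Lemma coset_rep_shift j k : j <= k -> k.+1 < m ->
  s k * coset_rep j = coset_rep j * s k.+1.
Proof.
move=> jk; have [d] := ubnP (k - j); elim: d j jk => // d IH j jk dk km.
rewrite (@coset_repS j); last by lia.
have [ejk|njk] := eqVneq j k.
  subst j; rewrite coset_repS // mulgA mulgA coset_rep_comm //.
  by rewrite -!mulgA; congr (_ * _); rewrite !mulgA s_braid.
rewrite mulgA IH; try lia.
by rewrite -!mulgA; congr (_ * _); rewrite -s_comm //; lia.
Qed.

(** The pure braid in which the last strand winds once around strand [i]. *)
Definition winding (i : nat) : G := coset_rep i * s i * (coset_rep i.+1)^-1.

Lemma windingE i : winding i * coset_rep i.+1 = coset_rep i * s i.
Proof. by rewrite /winding mulgVK. Qed.

Lemma winding_far k i c : s k * coset_rep i = coset_rep i * c ->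
  s k * coset_rep i.+1 = coset_rep i.+1 * c -> c * s i = s i * c ->
  s k * winding i = winding i * s k.
Proof.
move=> h1 h2 h3; apply: (mulIg (coset_rep i.+1)).
rewrite -[LHS]mulgA windingE -[RHS]mulgA h2 mulgA [RHS]mulgA windingE.
by rewrite h1 -!mulgA h3.
Qed.

(** Moving a generator of the other strands past the loops of the last strand
    is Artin's action on the free group of these loops. *)
Lemma winding_conj k i : k.+1 < m -> i < m ->
  s k * winding i = word_val winding (act_letter (k, true) (i, true)) * s k.
Proof.
move=> km im.
have xyx : s k * s k.+1 * s k = s k.+1 * s k * s k.+1 by exact: s_braid.
set c := coset_rep k.+2.
have xc : s k * c = c * s k by rewrite coset_rep_comm.
have wk : winding k = c * (s k.+1 * s k * s k / s k.+1) / c.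
  rewrite /winding (coset_repS (ltnW km)) (coset_repS km) invgM.
  by rewrite !mulgA.
have wk1 : winding k.+1 = c * (s k.+1 * s k.+1) / c.
  by rewrite /winding (coset_repS km) !mulgA.
rewrite /act_letter; case: (eqVneq i k) => [->|nik]; last first.
  case: (eqVneq i k.+1) => [->|nik1]; last first.
    rewrite word_val1 /letter_val /=.
    have [ki|ik] := ltnP k i.
      apply: (@winding_far _ _ (s k)); try (rewrite coset_rep_comm //; lia).
      by rewrite s_comm //; lia.
    apply: (@winding_far _ _ (s k.+1)); try (rewrite coset_rep_shift //; lia).
    by rewrite -s_comm //; lia.
  rewrite /= /letter_val /= mulg1.
  set y := s k.+1 in xyx wk wk1 *; set x := s k in xyx xc wk *.
  have -> : (winding k.+1)^-1 * (winding k * winding k.+1) =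
      c * ((y * y)^-1 * (y * x * x / y) * (y * y)) / c.
    by rewrite wk wk1 !invgM invgK -!mulgA !mulKg.
  rewrite wk1; apply: conj_slide => //.
  apply: (mulgI (y * y)); rewrite invgM -!mulgA !mulVKg !mulKg; congr (_ * _).
  by rewrite !mulgA -xyx -!mulgA; congr (_ * _); rewrite !mulgA xyx.
rewrite word_val1 /letter_val /= wk wk1; apply: conj_slide => //.
apply: (mulIg (s k.+1)); rewrite -!mulgA mulVg mulg1 !mulgA xyx -!mulgA.
by congr (_ * _); rewrite !mulgA xyx.
Qed.
End Evaluation.

Section Completeness.
Variable G : groupType.
Local Open Scope group_scope.

Definition braid_family (m : nat) (s : nat -> G) : Prop :=
  (forall i j, i.+1 < j -> j < m -> s i * s j = s j * s i) /\
  (forall i, i.+1 < m -> s i * s i.+1 * s i = s i.+1 * s i * s i.+1).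

Lemma braid_familyW m n s : m <= n -> braid_family n s -> braid_family m s.
Proof.
move=> mn [h1 h2]; split=> [i j ij jm|i im]; first by apply: h1 => //; lia.
by apply: h2; lia.
Qed.

Variables (m : nat) (s : nat -> G).
Hypothesis sF : braid_family m.+1 s.
Let W := word_val (winding m.+1 s).
Let V := word_val s.
Let D := coset_rep m.+1 s.

Lemma winding_act_pos k u : k < m -> bounded m.+1 u ->
  s k * W u = W (act_word (k, true) u) * s k.
Proof.
case: sF => sc sb km; elim: u => [|[i d] u IH] /=; first by rewrite /W /= mulg1 mul1g.
move=> /andP[/= im /IH e].
rewrite -[act_word _ _]/(act_letter (k, true) (i, d) ++ act_word (k, true) u).
rewrite /W word_val_cat -/W -[RHS]mulgA -e.
rewrite !mulgA; congr (_ * _).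
have h := winding_conj sc sb (km : k.+1 < m.+1) im.
case: d {u IH e} => //.
rewrite -[(i, false)]/(inv_letter (i, true)) act_letter_inv /W word_val_inv.
rewrite letter_val_inv [letter_val _ _]/(winding m.+1 s i).
apply: (mulIg (winding m.+1 s i)).
by rewrite mulgVK -mulgA h mulKg.
Qed.

Lemma winding_act_letter x u : x.1 < m -> bounded m.+1 u ->
  letter_val s x * W u = W (act_word x u) * letter_val s x.
Proof.
case: x => k [] /= km bu; first exact: winding_act_pos.
rewrite /letter_val /=; apply: (mulgI (s k)).
rewrite mulVKg mulgA winding_act_pos ?bounded_act_word // mulgK.
have := red_act_beq u (beq_inv k true); rewrite /= => /(congr1 W).
by rewrite /W !word_val_red.
Qed.

Lemma winding_act b u : bounded m b -> bounded m.+1 u ->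
  V b * W u = W (act b u) * V b.
Proof.
move=> + bu; elim: b => [|x b IH] /=; first by rewrite mul1g mulg1.
move=> /andP[xm bb]; rewrite -[LHS]mulgA -/(V b) IH // !mulgA.
by rewrite winding_act_letter ?bounded_act.
Qed.

Definition comb_val (st : comb_state) : G := W st.1.1 * V st.1.2 * D st.2.

(** The table of [comb_step]: the four letters at the coset give the definition
    of a loop or of the next representative, and all others pass through. *)
Lemma coset_letter j x : x.1 < m.+1 -> j <= m.+1 ->
  D j * letter_val s x = comb_val (comb_step ([::], [::], j) x).
Proof.
case: sF => sc sb; case: x => i e /= im jm; rewrite /comb_val /D.
have gen k l : s k * D j = D j * s l ->
    D j * letter_val s (l, e) = 1 * V [:: (k, e)] * D j.
  rewrite mul1g /V word_val1 /letter_val; case: e => //= h.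
  by apply: (mulIg (s l)); rewrite mulgVK -mulgA -h mulKg.
have dS k : k < m.+1 -> D k = D k.+1 * s k by exact: coset_repS.
case: (eqVneq i j) => [ij|nij]; [|case: (eqVneq i.+1 j) => [ij|nij1]].
- subst j; case: e {gen} => /=; rewrite /W /V /= !mulg1 ?mul1g.
    by rewrite /letter_val /= windingE.
  by rewrite /letter_val /= -/D (dS i) // mulgK.
- subst j; case: e {gen} => /=; rewrite /W /V /= !mulg1 ?mul1g.
    by rewrite /letter_val /= -/D (dS i).
  rewrite /letter_val /= /winding !invgM invgK -!mulgA -/D; congr (_ * _).
  by rewrite mulVg mulg1.
- apply: gen; case: ltnP => ji.
    have := @coset_rep_shift _ _ _ sc sb j i.-1.
    by rewrite prednK; [apply; lia | lia].
  by apply: coset_rep_comm => //; lia.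
Qed.

Lemma comb_step_val st x : x.1 < m.+1 -> comb_bounded m st ->
  comb_val (comb_step st x) = comb_val st * letter_val s x.
Proof.
case: st => [[f b] j] xm bst.
have [bf bb jm] : [/\ bounded m.+1 f, bounded m b & j <= m.+1] by exact/and3P.
have -> : comb_step (f, b, j) x = comb_mul f b (comb_step ([::], [::], j) x).
  by rewrite -comb_step_mul /= act_nil !cats0.
rewrite [comb_val (f, b, j)]/(W f * V b * D j) -[RHS]mulgA (coset_letter xm jm).
have /and3P[] : comb_bounded m (comb_step ([::], [::], j) x).
  by apply: comb_step_bounded => //; rewrite /comb_bounded.
case: (comb_step _ x) => [[f' b'] j'] /= bf' bb' jm'.
rewrite /comb_val /= /W /V !word_val_cat -/W -/V !mulgA; congr (_ * _ * _).
by rewrite -!mulgA; congr (_ * _); rewrite winding_act.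
Qed.

Lemma comb_word_val st w : bounded m.+1 w -> comb_bounded m st ->
  comb_val (comb st w) = comb_val st * V w.
Proof.
elim: w st => [|x w IH] st /=; first by rewrite /V /= mulg1.
move=> /andP[xm bw] bst; rewrite IH ?comb_step_bounded // comb_step_val //.
by rewrite -mulgA.
Qed.
End Completeness.

(** Combing rewrites a word by consequences of the braid relations on the first
    [m] generators, so its verdict holds in every group with elements that
    satisfy them. *)
Lemma trivialb_word_val (G : groupType) m (s : nat -> G) w :
  braid_family m s -> bounded m w -> trivialb m w -> word_val s w = 1%g.
Proof.
elim: m w => [|m IH] w sF bw; first by move=> /eqP ->.
have bst : comb_bounded m ([::], [::], m.+1) by rewrite /comb_bounded /=.
have /and3P[] := comb_bounded_comb bw bst; have := comb_word_val sF bw bst.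
rewrite /= [in RHS]/comb_val /= coset_rep_last !mul1g => <-.
case: (comb _ w) => [[f b] j] /= _ bb _ /and3P[/eqP-> /eqP rf tb].
rewrite /comb_val /= coset_rep_last mulg1 IH //; last exact: braid_familyW sF.
by rewrite mulg1 -word_val_red rf.
Qed.

(** * The word problem of the braid group *)

Lemma beq_invr w : beq (w ++ inv_word w) [::].
Proof.
elim: w => [|x w IH]; first exact: beq_refl.
rewrite -cat1s inv_word_cat -catA; case: x => i e.
apply: beq_trans (beq_inv i e); rewrite -[[:: _; _]]/([:: (i, e)] ++ [::] ++ _).
by rewrite [w ++ _]catA; apply: beq_cat (beq_refl _) (beq_cat IH (beq_refl _)).
Qed.

Lemma beq_cancelr u v w : beq (u ++ w) v -> beq u (v ++ inv_word w).
Proof.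
move=> h; apply: beq_trans (beq_cat h (beq_refl (inv_word w))).
by rewrite -catA -{1}(cats0 u); apply: beq_cat (beq_refl _) (beq_sym (beq_invr w)).
Qed.

Section BraidGroup.
Variable n : nat.
Local Notation B := (braid_group n).

Definition braid_inv_word (b : word n) : word n :=
  rev (map (fun x => (x.1, ~~ x.2)) b).

Lemma braid_inv_wordK : involutive braid_inv_word.
Proof.
move=> b; rewrite /braid_inv_word map_rev revK -map_comp map_id_in // => -[i e] _ /=.
by rewrite negbK.
Qed.

Lemma braid_eq_invr (b : word n) : braid_eq (b ++ braid_inv_word b) [::].
Proof.
elim: b => [|x b IH]; first exact: braid_refl.
rewrite /braid_inv_word /= rev_cons -cats1 -/(braid_inv_word b) catA.
case: x => i e; apply: braid_trans (braid_inv i e).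
rewrite -[X in braid_eq X]cat1s -[X in braid_eq _ X]/([:: (i, e)] ++ [::] ++ _).
exact: braid_cat (braid_refl _) (braid_cat IH (braid_refl _)).
Qed.

Lemma braid_eq_inv (b c : word n) :
  braid_eq b c -> braid_eq (braid_inv_word b) (braid_inv_word c).
Proof.
move=> bc; have h1 := braid_eq_invr (braid_inv_word b).
rewrite braid_inv_wordK in h1.
apply: (@braid_trans _ _ (braid_inv_word b ++ (c ++ braid_inv_word c))).
  rewrite -{1}(cats0 (braid_inv_word b)).
  exact: braid_cat (braid_refl _) (braid_sym (braid_eq_invr c)).
rewrite catA -{2}(cat0s (braid_inv_word c)); apply: braid_cat (braid_refl _).
apply: braid_trans h1; exact: braid_cat (braid_refl _) (braid_sym bc).
Qed.

HB.instance Definition _ := Choice.copy B {eq_quot (braid_equiv n)}%qT.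

Definition class_word (x : B) : word n := repr (x : {eq_quot (braid_equiv n)}%qT).

Lemma class_wordK x : braid_class (class_word x) = x.
Proof. exact: reprK. Qed.

Lemma class_word_eq b : braid_eq (class_word (braid_class b)) b.
Proof. by apply/braid_classP; rewrite class_wordK. Qed.

Definition braid_mul (x y : B) : B := braid_class (class_word x ++ class_word y).
Definition braid_one : B := braid_class [::].
Definition braid_opp (x : B) : B := braid_class (braid_inv_word (class_word x)).

Lemma braid_mulE b c :
  braid_mul (braid_class b) (braid_class c) = braid_class (b ++ c).
Proof. by apply/braid_classP; apply: braid_cat; exact: class_word_eq. Qed.

Lemma braid_oppE b : braid_opp (braid_class b) = braid_class (braid_inv_word b).
Proof. by apply/braid_classP/braid_eq_inv; exact: class_word_eq. Qed.

Lemma braid_mulA : associative braid_mul.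
Proof.
move=> x y z; rewrite -(class_wordK x) -(class_wordK y) -(class_wordK z).
by rewrite !braid_mulE catA.
Qed.

Lemma braid_mul1g : left_id braid_one braid_mul.
Proof. by move=> x; rewrite -(class_wordK x) braid_mulE. Qed.

Lemma braid_mulg1 : right_id braid_one braid_mul.
Proof. by move=> x; rewrite -(class_wordK x) braid_mulE cats0. Qed.

Lemma braid_mulgV : right_inverse braid_one braid_opp braid_mul.
Proof.
move=> x; rewrite -(class_wordK x) braid_oppE braid_mulE.
by apply/braid_classP; exact: braid_eq_invr.
Qed.

Lemma braid_mulVg : left_inverse braid_one braid_opp braid_mul.
Proof.
move=> x; rewrite -(class_wordK x) braid_oppE braid_mulE.
rewrite -{2}(braid_inv_wordK (class_word x)).
by apply/braid_classP; exact: braid_eq_invr.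
Qed.

HB.instance Definition _ := isGroup.Build B braid_mulA braid_mul1g braid_mulg1
  braid_mulVg braid_mulgV.
End BraidGroup.

Lemma braid_class_cat n (b c : word n) :
  braid_class (b ++ c) = (braid_class b * braid_class c)%g.
Proof. by rewrite [RHS]braid_mulE. Qed.

Lemma braid_class_inv n (b : word n) :
  braid_class (braid_inv_word b) = (braid_class b)^-1%g.
Proof. by rewrite [RHS]braid_oppE. Qed.

Definition raw_letter n (x : letter n) : sletter := (val x.1, x.2).
Definition raw n (b : word n) : sword := map (@raw_letter n) b.

Lemma raw_cat n (b c : word n) : raw (b ++ c) = raw b ++ raw c.
Proof. exact: map_cat. Qed.

Lemma raw_bounded n (b : word n) : bounded n.-1 (raw b).
Proof. by rewrite /bounded all_map; apply/allP => -[i e] _ /=. Qed.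

Lemma raw_onto n (w : sword) : bounded n.-1 w -> exists b : word n, w = raw b.
Proof.
elim: w => [|[i e] w IH] /=; first by exists [::].
by move=> /andP[im /IH[b ->]]; exists ((Ordinal im, e) :: b).
Qed.

Lemma braid_eq_raw n (b c : word n) : braid_eq b c -> beq (raw b) (raw c).
Proof.
elim=> {b c} [i e|i j|i j ij|b|b c _|b c d _ h1 _ h2|b b' c c' _ h1 _ h2].
- exact: beq_inv.
- by case/orP => h; [|apply: beq_sym]; exact: beq_comm.
- by rewrite /raw /raw_letter /= ij; exact: beq_braid.
- exact: beq_refl.
- exact: beq_sym.
- exact: beq_trans h1 h2.
- by rewrite !raw_cat; exact: beq_cat.
Qed.

Definition generator n (i : nat) : braid_group n :=
  if insub i is Some j then braid_class [:: sigma j] else 1%g.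

Lemma generator_family n : braid_family n.-1 (@generator n).
Proof.
split=> [i j ij jn|i i1n].
  rewrite /generator (insubT (fun k => k < n.-1) jn).
  have h : i < n.-1 by lia.
  rewrite (insubT (fun k => k < n.-1) h) -!braid_class_cat.
  by apply/braid_classP; apply: braid_comm; rewrite /= ij.
have h : i < n.-1 by lia.
rewrite /generator (insubT (fun k => k < n.-1) h) (insubT (fun k => k < n.-1) i1n).
set x := sigma _; set y := sigma _.
have : braid_class (([:: x] ++ [:: y]) ++ [:: x]) =
       braid_class (([:: y] ++ [:: x]) ++ [:: y]).
  by apply/braid_classP; exact: (@braid_braid n (Ordinal h) (Ordinal i1n) erefl).
by rewrite !braid_class_cat.
Qed.

Lemma generator_val n (b : word n) : word_val (@generator n) (raw b) = braid_class b.
Proof.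
elim: b => // -[i e] b IH.
rewrite -[word_val _ _]/(letter_val (@generator n) (val i, e) * word_val _ (raw b))%g IH.
have gi : generator n i = braid_class [:: sigma i].
  by rewrite /generator /= valK.
by case: e; rewrite /letter_val /= gi; rewrite -?braid_class_inv -braid_class_cat.
Qed.

(** The braid group itself is such a group. *)
Lemma trivialb_complete m w : bounded m w -> trivialb m w -> beq w [::].
Proof.
move=> bw tw; have [b ew] := @raw_onto m.+1 w bw; rewrite ew.
apply: (@braid_eq_raw _ _ [::]); apply/braid_classP.
rewrite -generator_val -ew; apply: (@trivialb_word_val _ m) => //.
exact: (generator_family m.+1).
Qed.

Definition braid_eq_test (m : nat) (b c : sword) : bool :=
  trivialb m (b ++ inv_word c).

Lemma braid_eq_testP n (b c : word n) :
  reflect (braid_eq b c) (braid_eq_test n.-1 (raw b) (raw c)).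
Proof.
have raw_inv : inv_word (raw c) = raw (braid_inv_word c).
  by rewrite /inv_word /raw /braid_inv_word map_rev -!map_comp.
rewrite /braid_eq_test raw_inv -raw_cat; apply: (iffP idP) => h.
  have e : braid_class (b ++ braid_inv_word c) = 1%g.
    rewrite -generator_val; apply: trivialb_word_val h => //.
      exact: generator_family.
    exact: raw_bounded.
  apply/braid_classP; move: e; rewrite braid_class_cat braid_class_inv.
  exact: divg1_eq.
apply: trivialb_sound; first exact: raw_bounded.
apply: (@braid_eq_raw n _ [::]); apply: braid_trans (braid_eq_invr c).
exact: braid_cat h (braid_refl _).
Qed.

(** * Bounding the exponent of a power *)

Lemma beq_pow k u v : beq u v -> beq (pow k u) (pow k v).
Proof.
by move=> e; elim: k => [|k IH]; [exact: beq_refl | exact: beq_cat].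
Qed.

Lemma pow_nil k : pow k [::] = [::].
Proof. by elim: k. Qed.

Definition coset_move (w : sword) (j : nat) : nat := (comb ([::], [::], j) w).2.

Lemma coset_move_cat u v j : coset_move (u ++ v) j = coset_move v (coset_move u j).
Proof.
rewrite /coset_move comb_cat; case: (comb _ u) => [[f b] k].
by rewrite comb_start; case: (comb _ v) => [[f' b'] k'].
Qed.

Lemma coset_moveK w : cancel (coset_move w) (coset_move (inv_word w)).
Proof.
move=> j; rewrite -coset_move_cat.
by case: (comb_beq_start j (beq_invr w)).
Qed.

Lemma coset_move_le m w j : bounded m.+1 w -> j <= m.+1 -> coset_move w j <= m.+1.
Proof. by move=> bw jm; have /and3P[] := comb_start_bounded jm bw. Qed.

(** A braid permutes the finitely many cosets. *)
Lemma coset_period m w : bounded m.+1 w ->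
  exists2 q, 0 < q <= m.+2 & coset_move (pow q w) m.+1 = m.+1.
Proof.
move=> bw; pose f (j : 'I_m.+2) : 'I_m.+2 := inord (coset_move w j).
have f_val j : f j = coset_move w j :> nat.
  by rewrite inordK // ltnS coset_move_le // -ltnS.
have f_inj : injective f.
  move=> i j /(congr1 val); rewrite /= !f_val => /(can_inj (coset_moveK w)).
  exact: val_inj.
have iter_val k : coset_move (pow k w) m.+1 = iter k f ord_max :> nat.
  by elim: k => //= k IH; rewrite powSr coset_move_cat IH f_val.
exists (fingraph.order f ord_max); last by rewrite iter_val iter_order.
rewrite order_gt0 /=; have := max_card (mem (fconnect f ord_max)).
by rewrite card_ord.
Qed.

(** The two components of a word in the semidirect product, for words that bring
    the last strand back to its place. *)
Definition loop_part (m : nat) (w : sword) : sword := (comb ([::], [::], m) w).1.1.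
Definition braid_part (m : nat) (w : sword) : sword := (comb ([::], [::], m) w).1.2.

Lemma comb_parts m w :
  comb ([::], [::], m) w = (loop_part m w, braid_part m w, coset_move w m).
Proof.
by rewrite /loop_part /braid_part /coset_move; case: (comb _ w) => [[]].
Qed.

Lemma parts_cat m u v : coset_move u m = m ->
  loop_part m (u ++ v) = loop_part m u ++ act (braid_part m u) (loop_part m v) /\
  braid_part m (u ++ v) = braid_part m u ++ braid_part m v.
Proof.
move=> um; rewrite {1}/loop_part {2}/braid_part comb_cat comb_parts um comb_start.
by rewrite comb_parts.
Qed.

Lemma coset_move_pow m u k : coset_move u m = m -> coset_move (pow k u) m = m.
Proof. by move=> um; elim: k => // k IH; rewrite powS coset_move_cat um. Qed.

Lemma braid_part_pow m u k : coset_move u m = m ->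
  braid_part m (pow k u) = pow k (braid_part m u).
Proof. by move=> um; elim: k => // k IH; rewrite !powS (parts_cat _ um).2 IH. Qed.

Lemma loop_part_pow m u k : coset_move u m = m -> beq (braid_part m u) [::] ->
  red (loop_part m (pow k u)) = red (pow k (loop_part m u)).
Proof.
move=> um bu; elim: k => // k IH; rewrite !powS (parts_cat _ um).1.
by apply: red_cat => //; rewrite (red_act_beq _ bu).
Qed.

Lemma bounded_braid_part m w : bounded m.+1 w -> bounded m (braid_part m.+1 w).
Proof. by move=> bw; have /and3P[] := comb_start_bounded (leqnn m.+1) bw. Qed.

(** [m.+1] is the number of places of the last strand. *)
Fixpoint torsion_bound (m : nat) : nat :=
  if m is m'.+1 then m.+1 * torsion_bound m' else 1.

(** Here [y] bounds the lengths of the words on both sides after [v] has been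
    replaced by a power of it, and [y * 3 ^ y] those of their loop parts. *)
Fixpoint exponent_bound (m l : nat) : nat :=
  if m is m'.+1 then
    let t := torsion_bound m in let y := t.+1 * l in
    t * (exponent_bound m' (2 * y) + 2 * (y * 3 ^ y) + 1)
  else 0.

Lemma torsion_bound_gt0 m : 0 < torsion_bound m.
Proof. by elim: m => //= m IH; rewrite muln_gt0. Qed.

Lemma exponent_bound_mono m : {homo exponent_bound m : k l / k <= l}.
Proof.
elim: m => //= m IH k l kl; have := torsion_bound_gt0 m; set t := torsion_bound m.
move=> t0; rewrite leq_mul2l; apply/orP; right.
have h : (m.+2 * t).+1 * k <= (m.+2 * t).+1 * l by rewrite leq_mul2l kl orbT.
rewrite leq_add2r leq_add //; first by apply: IH; rewrite leq_mul2l h orbT.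
by rewrite leq_mul2l leq_mul // leq_exp2l.
Qed.

(** Once [v] is replaced by a power that brings the last strand back to its
    place, combing maps [v ^ k] to the [k]-th power of a braid with fewer strands
    and, when that braid is trivial, to the [k]-th power of an element of a free
    group.  If this element is nontrivial, the exponent is bounded by the length,
    and otherwise [v] has finite order. *)
Lemma power_bound m v : bounded m v ->
  (exists2 t, 0 < t <= torsion_bound m & beq (pow t v) [::]) \/
  (forall k a, bounded m a -> beq (pow k v) a ->
     k <= exponent_bound m (size v + size a)).
Proof.
elim: m v => [|m IH] v bv.
  left; exists 1 => //; case: v bv => // _; exact: beq_refl.
have [q /andP[q0 qm] vq] := coset_period bv.
have bvq : bounded m.+1 (pow q v) by exact: bounded_pow.
pose b := braid_part m.+1 (pow q v).
have bb : bounded m b by exact: bounded_braid_part.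
have t0 := torsion_bound_gt0 m; set t1 := torsion_bound m in t0 *.
(* Division of [k] by [Q]; the rest of the power moves to the right side. *)
have split_exp (Q k : nat) a : 0 < Q <= torsion_bound m.+1 -> bounded m.+1 a ->
    beq (pow k v) a -> let y := (torsion_bound m.+1).+1 * (size v + size a) in
  exists k1 a1, [/\ k <= Q * k1.+1, bounded m.+1 a1, size a1 <= y &
                    beq (pow k1 (pow Q v)) a1].
  move=> /andP[Q0 QT] ba kva y; exists (k %/ Q), (a ++ inv_word (pow (k %% Q) v)).
  have ltQ := ltn_pmod k Q0; have eqk := divn_eq k Q.
  split.
  - rewrite mulnC mulSn addnC; lia.
  - by rewrite bounded_cat ba bounded_inv bounded_pow.
  - rewrite size_cat size_inv_word size_pow /y.
    have : k %% Q * size v <= torsion_bound m.+1 * size v by rewrite leq_mul2r; lia.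
    nia.
  - by apply: beq_cancelr; rewrite -powM -powD mulnC -eqk.
have exp_le Q k k1 X : 0 < Q <= torsion_bound m.+1 -> k <= Q * k1.+1 ->
    k1 <= X -> k <= torsion_bound m.+1 * (X + 1).
  move=> /andP[Q0 QT] kk k1X; apply: leq_trans kk _; apply: leq_mul => //; lia.
have qT : 0 < q <= torsion_bound m.+1.
  rewrite q0; apply: leq_trans qm _; exact: leq_pmulr.
have size_vQ Q (a : sword) : 0 < Q <= torsion_bound m.+1 ->
   size (pow Q v) <= (torsion_bound m.+1).+1 * (size v + size a).
  move=> /andP[_ QT]; rewrite size_pow leq_mul //; lia.
have [[t /andP[t_gt0 tT] bt]|bnt] := IH b bb; last first.
  right=> k a ba kva; have [k1 [a1 [kk1 ba1 sa1 eq_a1]]] := split_exp q k a qT ba kva.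
  rewrite /=; set y := _.+1 * _ in sa1 *.
  apply: (exp_le q k k1 _ qT kk1).
  have [_ eq_b _] := comb_beq_start m.+1 eq_a1.
  rewrite -!/(braid_part _ _) braid_part_pow // -/b in eq_b.
  apply: leq_trans (bnt _ _ (bounded_braid_part ba1) eq_b) _.
  apply: leq_trans (leq_addr _ _); apply: exponent_bound_mono.
  have := comb_size_braid ([::], [::], m.+1) (pow q v).
  have := comb_size_braid ([::], [::], m.+1) a1.
  rewrite -!/(braid_part _ _) -/b /= !add0n; have := size_vQ q a qT; rewrite -/y; lia.
pose Q := q * t.
have QT : 0 < Q <= torsion_bound m.+1 by rewrite muln_gt0 q0 t_gt0 /= leq_mul.
have vQ : coset_move (pow Q v) m.+1 = m.+1 by rewrite powM coset_move_pow.
have bvQ : bounded m.+1 (pow Q v) by exact: bounded_pow.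
have bQ : beq (braid_part m.+1 (pow Q v)) [::] by rewrite powM braid_part_pow.
have [f0|f0] := eqVneq (red (loop_part m.+1 (pow Q v))) [::].
  left; exists Q => //; apply: (@trivialb_complete m.+1) => //=.
  rewrite comb_parts vQ f0 !eqxx /=.
  by apply: trivialb_sound => //; exact: bounded_braid_part.
right=> k a ba kva; have [k1 [a1 [kk1 ba1 sa1 eq_a1]]] := split_exp Q k a QT ba kva.
rewrite /=; set y := _.+1 * _ in sa1 *.
apply: (exp_le Q k k1 _ QT kk1).
have [eq_f _ _] := comb_beq_start m.+1 eq_a1.
rewrite -!/(loop_part _ _) loop_part_pow // in eq_f.
apply: leq_trans (free_power_bound f0 eq_f) _.
apply: leq_trans (leq_addl _ _).
have sz u : size u <= y -> size (loop_part m.+1 u) <= y * 3 ^ y.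
  move=> uy; apply: leq_trans (comb_size_free _ _) _; rewrite /= !add0n.
  by rewrite leq_mul // leq_exp2l.
have := sz _ sa1; have := sz _ (size_vQ Q a QT); lia.
Qed.

(** * Patterns as orbits of a deterministic automaton *)

(** Occupancy of the left and right positions, whether the strands turn, and
    whether the cell is a crossing of kind [T1]; the numbers of the strands are
    left out because they can be recovered by counting. *)
Definition profile := (bool * bool * bool * bool)%type.

Definition empty_profile : profile := (false, false, false, false).

Definition is_turn (d : direction) : bool := if d is Turn then true else false.
Definition turn_of (b : bool) : direction := if b then Turn else Straight.
Definition is_T1 (k : crossing_kind) : bool := if k is T1 then true else false.
Definition kind_of (b : bool) : crossing_kind := if b then T1 else T2.

Lemma is_turnK : cancel is_turn turn_of. Proof. by case. Qed.
Lemma is_T1K : cancel is_T1 kind_of. Proof. by case. Qed.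
Definition profile_of n (c : cell n) : profile :=
  (left_occupied c, right_occupied c, omap is_turn (cell_direction c) == Some true,
   omap is_T1 (cell_kind c) == Some true).

Definition profile_right_exit (s : profile) : option bool :=
  let: (l, r, t, _) := s in
  if t then (if l then Some true else None) else if r then Some false else None.

Definition profile_left_exit (s : profile) : option bool :=
  let: (l, r, t, _) := s in
  if t then (if r then Some true else None) else if l then Some false else None.

Definition profile_kind (s : profile) : option bool :=
  let: (l, r, t, k) := s in if [&& l, r & t] then Some k else None.

Definition proper_profile (s : profile) : bool :=
  let: (l, r, t, k) := s in (t ==> l || r) && (k ==> [&& l, r & t]).

Lemma profile_right_exitE n (c : cell n) :
  profile_right_exit (profile_of c) = omap is_turn (right_exit c).
Proof. by case: c => // -[]. Qed.

Lemma profile_left_exitE n (c : cell n) :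
  profile_left_exit (profile_of c) = omap is_turn (left_exit c).
Proof. by case: c => // -[]. Qed.

Lemma profile_kindE n (c : cell n) :
  profile_kind (profile_of c) = omap is_T1 (cell_kind c).
Proof. by case: c => // -[]. Qed.

Lemma profile_of_proper n (c : cell n) : proper_profile (profile_of c).
Proof. by case: c => // -[]. Qed.

Lemma nonempty_profile n (c : cell n) : nonempty c = (profile_of c != empty_profile).
Proof. by case: c => // -[]. Qed.

(** A turning rule and a crossing rule, as elements of a finite type. *)
Definition rule :=
  ({ffun option bool * option bool -> bool} *
   {ffun option bool * option bool -> bool})%type.

Definition child (rho : rule) (a b : profile) : profile :=
  let x := profile_right_exit a in let y := profile_left_exit b in
  let t := (isSome x || isSome y) && rho.1 (x, y) in
  (isSome x, isSome y, t,
   [&& isSome x, isSome y, t & rho.2 (profile_kind a, profile_kind b)]).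

Lemma omap_can T U (f : T -> U) (g : U -> T) :
  cancel f g -> cancel (omap f) (omap g).
Proof. by move=> fK [x|] //=; rewrite fK. Qed.

Definition turning_of (rho : rule) (a b : option direction) : direction :=
  turn_of (rho.1 (omap is_turn a, omap is_turn b)).

Definition crossing_of (rho : rule) (a b : option crossing_kind) : crossing_kind :=
  kind_of (rho.2 (omap is_T1 a, omap is_T1 b)).

Definition rule_of (tau : option direction -> option direction -> direction)
    (kappa : option crossing_kind -> option crossing_kind -> crossing_kind) : rule :=
  ([ffun p => is_turn (tau (omap turn_of p.1) (omap turn_of p.2))],
   [ffun p => is_T1 (kappa (omap kind_of p.1) (omap kind_of p.2))]).

Lemma child_of_rules n (A B C : cell n) tau kappa :
  (left_occupied C <-> right_exit A <> None) ->
  (right_occupied C <-> left_exit B <> None) ->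
  (nonempty C -> cell_direction C = Some (tau (right_exit A) (left_exit B))) ->
  (forall k, cell_kind C = Some k -> k = kappa (cell_kind A) (cell_kind B)) ->
  profile_of C = child (rule_of tau kappa) (profile_of A) (profile_of B).
Proof.
move=> hl hr ht hk; rewrite /child !profile_right_exitE !profile_left_exitE !profile_kindE /=.
rewrite !ffunE /= !(omap_can is_turnK) !(omap_can is_T1K).
have is_some T U (f : T -> U) (x : option T) : isSome (omap f x) = isSome x by case: x.
have el : isSome (right_exit A) = left_occupied C.
  apply/idP/idP; first by case E: (right_exit A) => // _; apply/hl; rewrite E.
  by move/hl; case: (right_exit A).
have er : isSome (left_exit B) = right_occupied C.
  apply/idP/idP; first by case E: (left_exit B) => // _; apply/hr; rewrite E.
  by move/hr; case: (left_exit B).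
rewrite !is_some el er.
case: C ht hk {hl hr el er} => [|i|i|i|i|i|k i] ht hk;
  rewrite /profile_of //= ?(negbTE _) //; try (move: (ht isT) => /= [<-] //).
by move: (hk _ erefl) => <-; case: (k).
Qed.

Lemma rules_of_child n (A B C : cell n) rho :
  profile_of C = child rho (profile_of A) (profile_of B) ->
  [/\ left_occupied C <-> right_exit A <> None,
      right_occupied C <-> left_exit B <> None,
      nonempty C ->
        cell_direction C = Some (turning_of rho (right_exit A) (left_exit B)) &
      forall k, cell_kind C = Some k ->
        k = crossing_of rho (cell_kind A) (cell_kind B)].
Proof.
rewrite /child !profile_right_exitE !profile_left_exitE !profile_kindE.
rewrite /turning_of /crossing_of.
set t := rho.1 _; set c := rho.2 _; case=> el er et ek.
have occ T U (f : T -> U) (x : option T) : isSome (omap f x) <-> x <> None by case: x.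
split; [by rewrite el; exact: occ|by rewrite er; exact: occ| |].
  rewrite -{}el -{}er in et; move: et {ek}.
  by case: C => [|i|i|i|i|i|k i] //=; case: (t).
rewrite -{}el -{}er in et ek; rewrite -{}et in ek.
by case: C ek => [|i|i|i|i|i|k i] //= ek _ [<-]; case: k ek => /= <-.
Qed.

(** ** Rows *)

Definition row := seq profile.

Definition row_at (r : row) (k : int) : profile :=
  if k is Posz i then nth empty_profile r i else empty_profile.

Fixpoint children_from (rho : rule) (a : profile) (r : row) : row :=
  if r is b :: r' then child rho a b :: children_from rho b r'
  else [:: child rho a empty_profile].

Definition trim_end : row -> row :=
  foldr (fun s r => if (s == empty_profile) && nilp r then [::] else s :: r) [::].

Definition trim (r : row) : row := rev (trim_end (rev (trim_end r))).

Definition step (rho : rule) (r : row) : row :=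
  trim (children_from rho empty_profile r).

Definition tight (r : row) : bool :=
  (head empty_profile r != empty_profile) && (last empty_profile r != empty_profile).

Lemma row_at_profile n (g : generation n) k :
  row_at (map (@profile_of n) (cells g)) k = profile_of (cell_at g k).
Proof.
case: k => //= i; have [lt_i|ge_i] := ltnP i (size (cells g)).
  by rewrite (nth_map NN).
by rewrite !nth_default // size_map.
Qed.

Lemma row_at_children rho r k :
  row_at (children_from rho empty_profile r) k =
  child rho (row_at r (k - 1)) (row_at r k).
Proof.
have h a i : nth empty_profile (children_from rho a r) i =
    child rho (nth empty_profile (a :: r) i) (nth empty_profile r i).
  by elim: r a i => [|b r IH] a [|i] //=; rewrite ?nth_nil ?IH.
case: k => [[|i]|i]; [by rewrite /= h | | by []].
by rewrite (_ : (Posz i.+1 - 1)%R = Posz i); [rewrite /= h | lia].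
Qed.

Lemma trim_endP r : exists e, r = trim_end r ++ nseq e empty_profile.
Proof.
elim: r => [|s r [e IH]] /=; first by exists 0.
case: eqP => [->|_] /=; last by exists e; rewrite /= -IH.
case: nilP => [r0|_]; last by exists e; rewrite /= -IH.
by exists e.+1; rewrite /= {1}IH r0.
Qed.

Lemma trim_end_last r : trim_end r != [::] -> last empty_profile (trim_end r) != empty_profile.
Proof.
elim: r => //= s r; case: (trim_end r) => [|y r'] IH /=; last by rewrite andbF /= IH.
by rewrite andbT; case: (s =P _) => //= /eqP.
Qed.

Lemma trimP r : exists e e', r = nseq e empty_profile ++ trim r ++ nseq e' empty_profile.
Proof.
have [e' er] := trim_endP r; have [e er'] := trim_endP (rev (trim_end r)).
exists e, e'; rewrite {1}er catA; congr (_ ++ _).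
by rewrite -[trim_end r]revK {1}er' rev_cat rev_nseq.
Qed.

Lemma trim_tight r : trim r != [::] -> tight (trim r).
Proof.
have [e er'] := trim_endP (rev (trim_end r)).
have er : trim_end r = nseq e empty_profile ++ trim r.
  by rewrite -[LHS]revK {1}er' rev_cat rev_nseq.
have head_rev (s : row) : head empty_profile (rev s) = last empty_profile s.
  by case/lastP: s => // s x; rewrite rev_rcons last_rcons.
move=> t0; apply/andP; split.
  rewrite /trim head_rev; apply: trim_end_last.
  by apply: contraNneq t0 => t0; rewrite /trim t0.
have := @trim_end_last r; rewrite er last_cat.
by case: (trim r) t0 => // x s _; apply; case: (e).
Qed.

Lemma row_at_trim r : exists e : int, forall k, row_at (trim r) k = row_at r (k + e).
Proof.
have [e [e' er]] := trimP r; exists (Posz e) => k; rewrite [in RHS]er.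
case: k => [i|i] /=.
  rewrite nth_cat size_nseq ltnNge leq_addl /= addnK nth_cat nth_nseq if_same.
  by case: ltnP => // ge_i; rewrite nth_default.
case: (boolP (0 <= Negz i + Posz e)%R) => h; last by case: (Negz i + Posz e)%R h.
have [j -> je] : exists2 j : nat, (Negz i + Posz e)%R = j & j < e.
  by exists (e - i.+1)%N; lia.
by rewrite /= nth_cat size_nseq je nth_nseq je.
Qed.

(** The first nonempty cell fixes the translation. *)
Lemma tight_shift_eq a b (e : int) : tight a -> tight b ->
  (forall k, row_at a k = row_at b (k + e)) -> a = b.
Proof.
move=> /andP[ha la] /andP[hb lb] hab.
have ge0 (r : row) k : row_at r k != empty_profile -> (0 <= k < Posz (size r))%R.
  case: k => [i|i] /=; last by [].
  by have [|h] := ltnP i (size r); [lia | rewrite nth_default ?eqxx].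
have at0 (r : row) : head empty_profile r = row_at r 0 by case: r.
have atl (r : row) : head empty_profile r != empty_profile ->
    last empty_profile r = row_at r (Posz (size r).-1).
  by rewrite /= nth_last; case: r.
have e0 : e = 0%R.
  have := ha; rewrite at0 hab => /ge0; have := hb.
  have -> : head empty_profile b = row_at a (- e)%R by rewrite hab at0; congr row_at; lia.
  by move=> /ge0 h1 h2; lia.
subst e; have {}hab k : row_at a k = row_at b k by rewrite hab addr0.
have a0 : 0 < size a by case: (a) ha => //=; rewrite eqxx.
have b0 : 0 < size b by case: (b) hb => //=; rewrite eqxx.
have le1 : size a <= size b by have := la; rewrite (atl _ ha) hab => /ge0; lia.
have le2 : size b <= size a by have := lb; rewrite (atl _ hb) -hab => /ge0; lia.
apply: (@eq_from_nth _ empty_profile); first by apply/eqP; rewrite eqn_leq le1.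
by move=> i _; exact: (hab i).
Qed.

(** ** Generations and rows *)

Definition strand_count (s : profile) : nat := let: (l, r, _, _) := s in l + r.

Definition profile_word (t : nat) (s : profile) : sword :=
  let: (l, r, tn, k) := s in if [&& l, r & tn] then [:: (t, k)] else [::].

(** The first component counts the strands already met, which is the index of
    the next strand. *)
Definition emit (st : nat * sword) (s : profile) : nat * sword :=
  (st.1 + strand_count s, st.2 ++ profile_word st.1 s).

Definition row_scan : row -> nat * sword := foldl emit (0, [::]).

Definition valid_row (n w : nat) (r : row) : bool :=
  [&& all proper_profile r, (row_scan r).1 == n, tight r & size r <= w].

Lemma emit_cell n (c : cell n) t u :
  strands c = iota t (size (strands c)) ->
  emit (t, u) (profile_of c) = (t + size (strands c), u ++ raw (cell_word c)).
Proof. by case: c => [|i|i|i|i|i|[] i] //= [<-]. Qed.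

Lemma emit_cells n (cs : seq (cell n)) t k u :
  flatten (map (@strands n) cs) = iota t k ->
  foldl emit (t, u) (map (@profile_of n) cs) =
  (t + k, u ++ raw (flatten (map (@cell_word n) cs))).
Proof.
elim: cs t k u => [|c cs IH] t k u /=.
  by case: k => //= _; rewrite addn0 cats0.
move=> e; have ek : k = size (strands c) + size (flatten (map (@strands n) cs)).
  by rewrite -size_cat e size_iota.
move/eqP: e; rewrite {1}ek iotaD eqseq_cat ?size_iota // => /andP[/eqP ec /eqP ecs].
by rewrite emit_cell // (IH _ _ _ ecs) ek raw_cat catA addnA.
Qed.

Definition label (n t : nat) (s : profile) : cell n :=
  match s with
  | (true, true, tn, k) =>
    if insub t is Some i then (if tn then RL (kind_of k) i else SS i) else NN
  | (true, false, tn, _) =>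
    if insub t is Some i then (if tn then RN i else SN i) else NN
  | (false, true, tn, _) =>
    if insub t is Some i then (if tn then NL i else NS i) else NN
  | _ => NN
  end.

Fixpoint label_row (n t : nat) (r : row) : seq (cell n) :=
  if r is s :: r' then label n t s :: label_row n (t + strand_count s) r' else [::].

Lemma label_profile n t s : proper_profile s -> t + strand_count s <= n ->
  profile_of (label n t s) = s /\ strands (label n t s) = iota t (strand_count s).
Proof.
case: s => [[[[] []] tn] k] /= ps le_n.
- have h : t < n.-1 by lia.
  rewrite (insubT (fun i => i < n.-1) h) /=; case: tn ps => /=; last by case: k.
  by case: k.
- have h : t < n by lia.
  by rewrite (insubT (fun i => i < n) h) /=; case: tn ps; case: k.
- have h : t < n by lia.
  by rewrite (insubT (fun i => i < n) h) /=; case: tn ps; case: k.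
- by case: tn ps => //; case: k.
Qed.

Lemma emit_count r t u : (foldl emit (t, u) r).1 = t + sumn (map strand_count r).
Proof.
by elim: r t u => [|s r IH] t u /=; rewrite ?addn0 // /emit /= IH addnA.
Qed.

Lemma label_row_ok n r t : all proper_profile r ->
  t + sumn (map strand_count r) <= n ->
  map (@profile_of n) (label_row n t r) = r /\
  flatten (map (@strands n) (label_row n t r)) = iota t (sumn (map strand_count r)).
Proof.
elim: r t => //= s r IH t /andP[ps pr] le_n.
have [-> ->] := label_profile ps (leq_trans (leq_add (leqnn t) (leq_addr _ _)) le_n).
rewrite addnA in le_n; have [-> ->] := IH _ pr le_n.
by rewrite -iotaD.
Qed.

Lemma generation_row n (g : generation n) :
  is_generation g ->
  row_scan (map (@profile_of n) (cells g)) =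
    (n, raw (flatten (map (@cell_word n) (cells g)))) /\
  valid_row n (width g) (map (@profile_of n) (cells g)).
Proof.
move=> /and3P[/eqP gs gh gl]; have e := emit_cells [::] gs.
rewrite add0n cat0s in e; rewrite /row_scan e /valid_row /row_scan e eqxx size_map.
rewrite leqnn /tight !andbT; split=> //; apply/and3P; split=> //.
  by elim: (cells g) => // c cs IH; apply/andP; split; first exact: profile_of_proper.
apply/andP; split; first by move: gh; rewrite nonempty_profile; case: (cells g).
by move: gl; rewrite nonempty_profile -(last_map (@profile_of n)).
Qed.

Lemma row_generation n w (a : int) r : valid_row n w r ->
  let g := Generation a (label_row n 0 r) in
  [/\ is_generation g, map (@profile_of n) (cells g) = r & width g <= w].
Proof.
move=> /and4P[pr /eqP]; rewrite /row_scan emit_count add0n => en /andP[tr1 tr2] sr /=.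
have [e1 e2] := @label_row_ok n r 0 pr (eq_leq en).
split=> //; last by rewrite /width /= -(size_map (@profile_of n)) e1.
rewrite /is_generation /= e2 en eqxx !nonempty_profile /=.
rewrite -[in head _ _]e1 -[in last _ _]e1 in tr1 tr2.
rewrite -[empty_profile]/(profile_of (@NN n)) last_map in tr2.
by apply/andP; split=> //; move: tr1; case: (label_row n 0 r).
Qed.

Section Links.
Variable n : nat.
Implicit Types (g h : generation n) (p : pattern n).

Definition linked (rho : rule) g h : Prop :=
  exists2 d : int, start h = (start g + d *+ 2 + 1)%R &
    forall k, profile_of (cell_at h k) =
      child rho (profile_of (cell_at g (k + d))) (profile_of (cell_at g (k + d + 1))).

Fixpoint chain (R : generation n -> generation n -> Prop) p : Prop :=
  match p with
  | g :: ((h :: _) as p') => R g h /\ chain R p'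
  | _ => True
  end.

Lemma chainP R p : chain R p <-> forall g h, consecutive p g h -> R g h.
Proof.
split.
  move=> + g h [p1 [p2 ep]]; elim: p1 p ep => [|g1 p1 IH] p -> /=; first by case.
  by case: p1 IH => [|g2 p1] IH /= [_ hc]; exact: (IH _ erefl).
elim: p => // g [|h p] IH //= hR; split; first by apply: hR; exists [::], p.
by apply: IH => g' h' [p1 [p2 ep]]; apply: hR; exists (g :: p1), p2; rewrite ep.
Qed.

Lemma SCA_chain p : is_SCA_pattern p <->
  is_pattern p /\ exists rho, chain (linked rho) p.
Proof.
split=> [[pp [cp1 cp2] [tau ht] [kappa hk]]|[pp [rho /chainP hc]]].
  split=> //; exists (rule_of tau kappa); apply/chainP => g h gh.
  have [d hd] := cp1 g h gh 0%R; rewrite /left_position mul0rn addr0 in hd.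
  exists d => // k.
  have ch : child_of p (cell_at g (k + d)) (cell_at g (k + d + 1)) (cell_at h k).
    by exists g, h, (k + d)%R, k; split=> //; rewrite /left_position hd !mulr2n; lia.
  have [hl hr] := cp2 _ _ _ ch.
  by apply: child_of_rules => //; [exact: ht|exact: hk].
have child_linked A B C : child_of p A B C ->
    profile_of C = child rho (profile_of A) (profile_of B).
  move=> [g [h [k [k' [gh pos -> -> ->]]]]]; have [d hd hch] := hc _ _ gh.
  rewrite /left_position hd in pos.
  by have -> : k = (k' + d)%R by move: pos; rewrite !mulr2n; lia.
split=> //.
- split=> [g h gh k'|A B C /child_linked/rules_of_child[]//].
  have [d hd _] := hc _ _ gh; exists (k' + d)%R.
  by rewrite /left_position hd !mulr2n; lia.
- by exists (turning_of rho) => A B C /child_linked/rules_of_child[].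
- by exists (crossing_of rho) => A B C /child_linked/rules_of_child[].
Qed.

Lemma linked_step rho g h : is_generation g -> is_generation h -> linked rho g h ->
  map (@profile_of n) (cells h) = step rho (map (@profile_of n) (cells g)).
Proof.
move=> /generation_row[_ /and4P[_ _ _ _]] /generation_row[_ /and4P[_ _ th _]].
move=> [d _ hd]; set r := map _ (cells g); set r' := map _ (cells h) in th *.
have [e he] := row_at_trim (children_from rho empty_profile r).
have eq_at k : row_at r' k = row_at (step rho r) (k + (d + 1 - e)).
  rewrite row_at_profile hd he row_at_children -!row_at_profile.
  by congr (child _ (row_at _ _) (row_at _ _)); lia.
apply: (tight_shift_eq th _ eq_at); apply: trim_tight; apply: contraTneq th => s0.
suff r0 k : row_at r' k = empty_profile.
  rewrite /tight negb_and !negbK; case: (r') r0 => //= s r1 r0.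
  by rewrite (r0 0%R : s = _) eqxx.
by rewrite eq_at /step s0; case: (k + _)%R => // i; rewrite /= nth_nil.
Qed.

Lemma linked_label rho w (a : int) r :
  valid_row n w r -> valid_row n w (step rho r) ->
  exists a', linked rho (Generation a (label_row n 0 r))
                        (Generation a' (label_row n 0 (step rho r))).
Proof.
move=> /(row_generation a)[_ eg _] vr'.
have [e he] := row_at_trim (children_from rho empty_profile r).
(* The children start one place to the left of the row, with the child of an
   empty cell and the first cell, and trimming removes [e] cells. *)
exists (a + (e - 1) *+ 2 + 1)%R; exists (e - 1)%R => // k.
have [_ eh _] := row_generation (a + (e - 1) *+ 2 + 1)%R vr'.
rewrite -!row_at_profile eh eg he row_at_children.
by congr (child _ (row_at _ _) (row_at _ _)); lia.
Qed.
End Links.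

Definition orbit_valid (n w : nat) (rho : rule) (r : row) (len : nat) : bool :=
  all (fun i => valid_row n w (iter i (step rho) r)) (iota 0 len).

Definition orbit_word (rho : rule) (r : row) (len : nat) : sword :=
  flatten (map (fun i => (row_scan (iter i (step rho) r)).2) (iota 0 len)).

Lemma orbit_validS n w rho r len : orbit_valid n w rho r len.+1 =
  valid_row n w r && orbit_valid n w rho (step rho r) len.
Proof.
rewrite /orbit_valid /= -[1]/(1 + 0) iotaDl all_map; congr andb.
by apply: eq_all => i; rewrite /= -iterS iterSr.
Qed.

Lemma orbit_wordS rho r len : orbit_word rho r len.+1 =
  (row_scan r).2 ++ orbit_word rho (step rho r) len.
Proof.
rewrite /orbit_word /= -[1]/(1 + 0) iotaDl -map_comp; congr (_ ++ flatten _).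
by apply: eq_map => i; rewrite /= -iterS iterSr.
Qed.

Section Orbits.
Variables (n w : nat) (rho : rule).

Lemma valid_rowW v r : v <= w -> valid_row n v r -> valid_row n w r.
Proof. by move=> vw /and4P[? ? ? /leq_trans-/(_ _ vw)?]; apply/and4P. Qed.

Lemma chain_orbit (g : generation n) (p : pattern n) :
  is_pattern (g :: p) -> width_at_most w (g :: p) -> chain (linked rho) (g :: p) ->
  let r := map (@profile_of n) (cells g) in
  orbit_valid n w rho r (size p).+1 /\ orbit_word rho r (size p).+1 = raw (psi (g :: p)).
Proof.
elim: p g => [|h p IH] g /andP[gg pp] /andP[gw pw] gc r.
  have [e v] := generation_row gg.
  rewrite orbit_validS orbit_wordS (valid_rowW gw v) /r e.
  by rewrite /psi /= /orbit_word /= !cats0.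
have [e v] := generation_row gg; have [lgh hc] := gc.
have [ov ow] := IH h pp pw hc; have gh : is_generation h by case/andP: pp.
rewrite orbit_validS orbit_wordS (valid_rowW gw v) -(linked_step gg gh lgh) ov ow.
by rewrite /r e -raw_cat.
Qed.

Lemma orbit_chain r len (a : int) : orbit_valid n w rho r len ->
  exists p : pattern n, [/\ is_pattern p, width_at_most w p, chain (linked rho) p,
    raw (psi p) = orbit_word rho r len &
    if p is g :: _ then g = Generation a (label_row n 0 r) else True].
Proof.
elim: len r a => [|len IH] r a; first by exists [::].
rewrite orbit_validS orbit_wordS => /andP[vr vo].
have [gg eg gw] := row_generation a vr; set g := Generation _ _ in gg eg gw.
have [e _] := generation_row gg; rewrite eg in e.
have raw_psi p : raw (psi (g :: p)) = (row_scan r).2 ++ raw (psi p).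
  by rewrite e -raw_cat.
case: len IH vo => [|len] IH vo.
  by exists [:: g]; rewrite /is_pattern /width_at_most raw_psi /= gg gw.
have [a' lk] : exists a', linked rho g (Generation a' (label_row n 0 (step rho r))).
  by apply: linked_label vr _; move: vo; rewrite orbit_validS => /andP[].
have [p [pp pw pc ep hp]] := IH _ a' vo.
exists (g :: p); split=> //; first by rewrite /is_pattern /= gg.
- by rewrite /width_at_most /= gw.
- by case: p hp pc {pp pw ep} => // h p -> pc; split.
- by rewrite raw_psi ep.
Qed.
End Orbits.

(** The rules determine each row from the preceding one, and the translation of
    the first row is immaterial. *)
Lemma SCA_orbit n w (b : word n) :
  (exists p : pattern n,
     SCA_representation (braid_class b) p /\ width_at_most w p) <->
  exists rho r len, orbit_valid n w rho r len &&
    braid_eq_test n.-1 (orbit_word rho r len) (raw b).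
Proof.
split=> [[p [[/SCA_chain[pp [rho pc]] /braid_classP e] pw]]|].
  exists rho; case: p pp pc e pw => [|g p] pp pc e pw.
    by exists [::], 0; rewrite /=; apply/(@braid_eq_testP n [::] b).
  have [ov ow] := chain_orbit pp pw pc.
  exists (map (@profile_of n) (cells g)), (size p).+1.
  by rewrite ov ow; apply/braid_eq_testP.
move=> [rho [r [len /andP[ov t]]]]; have [p [pp pw pc ep _]] := orbit_chain 0%R ov.
exists p; split=> //; split; first by apply/SCA_chain; split=> //; exists rho.
by apply/braid_classP/braid_eq_testP; rewrite ep.
Qed.

(** * Bounding the length of a representation *)

Lemma braid_eq_test_beq m u v : bounded m u -> bounded m v ->
  reflect (beq u v) (braid_eq_test m u v).
Proof.
move=> bu bv; have buv : bounded m (u ++ inv_word v).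
  by rewrite bounded_cat bu bounded_inv.
apply: (iffP idP) => [/(trivialb_complete buv) h|h].
  have := beq_cancelr h; rewrite inv_wordK; exact.
apply: trivialb_sound => //; apply: beq_trans (beq_invr v).
exact: beq_cat h (beq_refl _).
Qed.

Lemma beq_cancel_ends u v x c : beq (u ++ v ++ x) c ->
  beq v (inv_word u ++ c ++ inv_word x).
Proof.
rewrite catA => /beq_cancelr h; rewrite -[v]cat0s.
apply: beq_trans (beq_cat (beq_refl (inv_word u)) h).
rewrite catA; apply: beq_cat (beq_refl _); apply: beq_sym.
by rewrite -{2}(inv_wordK u); exact: beq_invr.
Qed.

Fixpoint all_rows (w : nat) : seq row :=
  if w is w'.+1 then
    [::] :: flatten (map (fun s => map (cons s) (all_rows w')) (enum {: profile}))
  else [:: [::]].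

Lemma mem_all_rows w r : (r \in all_rows w) = (size r <= w).
Proof.
elim: w r => [|w IH] [|s r] //=; rewrite inE /=.
rewrite ltnS -IH; apply/flatten_mapP/idP => [[s' _ /mapP[r' ? [_ ->]]] //|rw].
by exists s; [rewrite mem_enum | apply/mapP; exists r].
Qed.

Lemma size_row_scan r : size (row_scan r).2 <= size r.
Proof.
rewrite /row_scan -[X in _ <= X]/(size (0, [::] : sword).2 + size r).
elim: r (0, [::] : sword) => [|s r IH] st /=; first by rewrite addn0.
apply: leq_trans (IH _) _; rewrite /emit /= size_cat.
by case: s => [[[l r'] t] k] /=; case: ifP => _ /=; lia.
Qed.

Section OrbitBound.
Variables (n w : nat) (rho : rule).

Lemma orbit_word_add r i j : orbit_word rho r (i + j) =
  orbit_word rho r i ++ orbit_word rho (iter i (step rho) r) j.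
Proof.
elim: i r => [|i IH] r; first by rewrite add0n.
by rewrite addSn !orbit_wordS IH catA iterSr.
Qed.

Lemma orbit_valid_add r i j : orbit_valid n w rho r (i + j) =
  orbit_valid n w rho r i && orbit_valid n w rho (iter i (step rho) r) j.
Proof.
elim: i r => [|i IH] r; first by rewrite add0n.
by rewrite addSn !orbit_validS IH andbA iterSr.
Qed.

Lemma orbit_word_bounded r len :
  orbit_valid n w rho r len -> bounded n.-1 (orbit_word rho r len).
Proof. by move/(@orbit_chain _ _ _ _ _ (Posz 0)) => [p [_ _ _ <- _]]; exact: raw_bounded. Qed.

Lemma orbit_word_size r len :
  orbit_valid n w rho r len -> size (orbit_word rho r len) <= len * w.
Proof.
elim: len r => // len IH r; rewrite orbit_validS orbit_wordS => /andP[vr vo].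
rewrite size_cat mulSn leq_add ?IH //; apply: leq_trans (size_row_scan r) _.
by case/and4P: vr.
Qed.

Lemma orbit_word_period r q k : iter q (step rho) r = r ->
  orbit_word rho r (k * q) = pow k (orbit_word rho r q).
Proof.
by move=> rq; elim: k => // k IH; rewrite mulSn orbit_word_add rq IH.
Qed.

Lemma iter_period r q k : iter q (step rho) r = r -> iter (k * q) (step rho) r = r.
Proof. by move=> rq; elim: k => // k IH; rewrite mulSn iterD IH. Qed.

(** There are only finitely many rows of width at most [w]. *)
Lemma orbit_repeats r len : orbit_valid n w rho r len -> size (all_rows w) < len ->
  exists i q, [/\ 0 < q, i + q <= size (all_rows w) &
    iter q (step rho) (iter i (step rho) r) = iter i (step rho) r].
Proof.
move=> vo lt_len; pose s := [seq iter i (step rho) r | i <- iota 0 (size (all_rows w)).+1].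
have size_s : size s = (size (all_rows w)).+1 by rewrite size_map size_iota.
have nth_s i : i <= size (all_rows w) -> nth [::] s i = iter i (step rho) r.
  by move=> iw; rewrite (nth_map 0) ?nth_iota ?size_iota.
have : ~~ uniq s.
  apply/negP => /uniq_leq_size-/(_ (all_rows w)); rewrite size_s ltnn.
  move=> h; suff: false by []; apply: h => x /mapP[i].
  rewrite mem_iota add0n => /andP[_ iw] ->; rewrite mem_all_rows.
  have /and4P[] // : valid_row n w (iter i (step rho) r).
  by move/allP: vo; apply; rewrite mem_iota add0n /=; lia.
move/(uniqPn [::]) => [i [j [ij]]]; rewrite size_s => jw; rewrite !nth_s; try lia.
move=> eq_ij; exists i, (j - i); split; try lia.
by rewrite -iterD subnK ?(ltnW ij).
Qed.

End OrbitBound.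

(** The factor counts the repetitions of a cycle, with two more for the rows
    before it and the incomplete last repetition. *)
Definition length_bound (m rows w l : nat) : nat :=
  rows * (torsion_bound m + exponent_bound m (3 * (rows * w) + l) + 2).

(** A long orbit runs through a cycle, so that its word has the form
    [u v ^ k x] with [u], [v] and [x] of bounded length.  If the class of [v]
    has finite order then [k] can be reduced modulo the order, and otherwise
    the braid [v ^ k] determines a bound on [k]. *)
Lemma short_orbit n w rho r len c : bounded n.-1 c ->
  orbit_valid n w rho r len -> beq (orbit_word rho r len) c ->
  exists2 len', len' <= length_bound n.-1 (size (all_rows w)) w (size c) &
    orbit_valid n w rho r len' /\ beq (orbit_word rho r len') c.
Proof.
move=> bc vo wc; set N := size (all_rows w); set m := n.-1.
have [leN|ltN] := leqP len N.
  exists len => //; apply: leq_trans leN _; apply: leq_pmulr; lia.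
have [i [q [q0 iqN rq]]] := orbit_repeats vo ltN.
rewrite -/N in iqN; set ri := iter i _ r in rq.
have [k [s [s_lt elen]]] : exists k s, s < q /\ len = i + (k * q + s).
  exists ((len - i) %/ q), ((len - i) %% q); rewrite ltn_pmod //; split=> //.
  by rewrite -divn_eq subnKC //; lia.
have valid_le len' : len' <= len -> orbit_valid n w rho r len'.
  by move=> le_len; have := vo; rewrite -(subnKC le_len) orbit_valid_add => /andP[].
have word_k k' : orbit_word rho r (i + (k' * q + s)) =
    orbit_word rho r i ++ pow k' (orbit_word rho ri q) ++ orbit_word rho ri s.
  by rewrite !orbit_word_add -/ri orbit_word_period // iter_period.
have iq_len : i + q <= len by lia.
set u := orbit_word rho r i in word_k; set v := orbit_word rho ri q in word_k.
set x := orbit_word rho ri s in word_k.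
have vi : orbit_valid n w rho r i by apply: valid_le; lia.
have vv : orbit_valid n w rho ri q.
  by have := valid_le _ iq_len; rewrite orbit_valid_add => /andP[].
have vx : orbit_valid n w rho ri s.
  have /valid_le : i + s <= len by lia.
  by rewrite orbit_valid_add => /andP[].
pose a := inv_word u ++ c ++ inv_word x.
have ba : bounded m a.
  by rewrite !bounded_cat !bounded_inv bc (orbit_word_bounded vi) (orbit_word_bounded vx).
have kva : beq (pow k v) a by apply: beq_cancel_ends; rewrite -word_k -elen.
have small k' : k' <= k -> k' <= torsion_bound m + exponent_bound m (3 * (N * w) + size c) ->
    beq (pow k' v) (pow k v) ->
    exists2 len', len' <= length_bound m N w (size c) &
      orbit_valid n w rho r len' /\ beq (orbit_word rho r len') c.
  move=> k'k k'B eq_k'; exists (i + (k' * q + s)); last split.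
  - rewrite /length_bound -/N; set B := (_ + exponent_bound _ _) in k'B *.
    have h := leq_mul k'B (_ : q <= N); have : k' * q <= B * N by apply: h; lia.
    by rewrite mulnDr (mulnC N B) muln2 -addnn; lia.
  - by apply: valid_le; rewrite elen leq_add2l leq_add2r leq_mul2r k'k orbT.
  - apply: beq_trans wc; rewrite word_k elen word_k.
    by apply: beq_cat (beq_refl _) (beq_cat eq_k' (beq_refl _)).
have [[t /andP[t0 tT] vt]|bk] := power_bound (orbit_word_bounded vv).
  apply: (small (k %% t)); first exact: leq_mod.
    by apply: leq_trans (ltnW (ltn_pmod k t0)) _; apply: leq_trans tT (leq_addr _ _).
  rewrite {2}(divn_eq k t) powD mulnC powM -{1}[pow (k %% t) v]cat0s.
  apply: beq_cat (beq_refl _); apply: beq_sym.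
  by have := beq_pow (k %/ t) vt; rewrite pow_nil.
apply: (small k) => //; last exact: beq_refl.
apply: leq_trans (bk _ _ ba kva) _; apply: leq_trans (leq_addl _ _).
apply: exponent_bound_mono; rewrite !size_cat !size_inv_word.
have h1 := orbit_word_size vv; have h2 := orbit_word_size vi; have h3 := orbit_word_size vx.
have le z : z <= N -> z * w <= N * w by move=> h; rewrite leq_mul2r h orbT.
have := le q; have := le i; have := le s; rewrite -/u -/v -/x in h1 h2 h3 *; lia.
Qed.

Definition search (n : nat) (c : sword) (w : nat) : bool :=
  has (fun rho => has (fun r => has (fun len =>
      orbit_valid n w rho r len && braid_eq_test n.-1 (orbit_word rho r len) c)
    (iota 0 (length_bound n.-1 (size (all_rows w)) w (size c)).+1))
    (all_rows w)) (enum {: rule}).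

Lemma searchP n (b : word n) w :
  reflect (exists p : pattern n,
             SCA_representation (braid_class b) p /\ width_at_most w p)
          (search n (raw b) w).
Proof.
apply: (iffP idP) => [|/SCA_orbit[rho [r [len /andP[vo t]]]]].
  move=> /hasP[rho _ /hasP[r _ /hasP[len _ h]]].
  by apply/SCA_orbit; exists rho, r, len.
have bb := raw_bounded b.
have wc := elimT (braid_eq_test_beq (orbit_word_bounded vo) bb) t.
have [len' le_len [vo' wc']] := short_orbit bb vo wc.
apply/hasP; exists rho; first by rewrite mem_enum.
have [r' r'w [vr' wr']] : exists2 r', r' \in all_rows w &
    orbit_valid n w rho r' len' /\ beq (orbit_word rho r' len') (raw b).
  case: len' vo' wc' {le_len} => [|len'] vo' wc'.
    by exists [::]; rewrite ?mem_all_rows.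
  exists r => //; rewrite mem_all_rows.
  by move: vo'; rewrite orbit_validS => /andP[/and4P[]].
apply/hasP; exists r' => //; apply/hasP; exists len'.
  by rewrite mem_iota add0n ltnS.
by rewrite vr'; apply/(braid_eq_test_beq (orbit_word_bounded vr') bb).
Qed.

(** * Recursive functions on natural numbers *)

Definition rec1 (f : nat -> nat) : Prop :=
  recursive (fun v : 1.-tuple nat => f (tnth v ord0)).

Definition rec2 (f : nat -> nat -> nat) : Prop :=
  recursive (fun v : 2.-tuple nat => f (tnth v ord0) (tnth v (lift ord0 ord0))).

Lemma recursive_ext k (f g : k.-tuple nat -> nat) :
  f =1 g -> recursive f -> recursive g.
Proof. by move=> /boolp.funext ->. Qed.

Lemma rec2_ext f g : (forall x y, f x y = g x y) -> rec2 f -> rec2 g.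
Proof. by move=> e; apply: recursive_ext => v; exact: e. Qed.

Lemma rec1_ext f g : f =1 g -> rec1 f -> rec1 g.
Proof. by move=> e; apply: recursive_ext => v; exact: e. Qed.

Lemma rec_app1 k f (g : k.-tuple nat -> nat) :
  rec1 f -> recursive g -> recursive (fun v => f (g v)).
Proof.
move=> hf hg; have := @rec_comp k 1 _ (fun _ => g) hf (fun _ => hg).
by apply: recursive_ext => v; rewrite tnth_mktuple.
Qed.

Lemma rec_app2 k f (g h : k.-tuple nat -> nat) :
  rec2 f -> recursive g -> recursive h -> recursive (fun v => f (g v) (h v)).
Proof.
move=> hf hg hh; pose a (i : 'I_2) := if i == ord0 then g else h.
have := @rec_comp k 2 _ a hf; rewrite /a => H; have {H} := H _.
have ha i : recursive (a i) by rewrite /a; case: ifP.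
by move=> /(_ ha); apply: recursive_ext => v; rewrite !tnth_mktuple.
Qed.

Lemma rec1_id : rec1 id.
Proof. exact: rec_proj. Qed.

Lemma rec1_succ : rec1 succn.
Proof. by apply: recursive_ext rec_succ => v. Qed.

Lemma rec_const k c : recursive (fun _ : k.-tuple nat => c).
Proof. by elim: c => [|c IH]; [exact: rec_zero | exact: rec_app1 rec1_succ IH]. Qed.

Lemma rec1_comp f g : rec1 f -> rec1 g -> rec1 (f \o g).
Proof. exact: rec_app1. Qed.

Lemma rec1_app2 f g h : rec2 f -> rec1 g -> rec1 h -> rec1 (fun x => f (g x) (h x)).
Proof. exact: rec_app2. Qed.

Lemma rec2_app1 f g : rec1 f -> rec2 g -> rec2 (fun x y => f (g x y)).
Proof. exact: rec_app1. Qed.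

Lemma rec2_app2 f g h : rec2 f -> rec2 g -> rec2 h ->
  rec2 (fun x y => f (g x y) (h x y)).
Proof. exact: rec_app2. Qed.

Lemma rec2_l f : rec1 f -> rec2 (fun x _ => f x).
Proof. by move=> hf; apply: rec_app1 hf (rec_proj _). Qed.

Lemma rec2_r f : rec1 f -> rec2 (fun _ y => f y).
Proof. by move=> hf; apply: rec_app1 hf (rec_proj _). Qed.

Lemma rec1_const c : rec1 (fun _ => c). Proof. exact: rec_const. Qed.
Lemma rec2_const c : rec2 (fun _ _ => c). Proof. exact: rec_const. Qed.

Definition rec3 (f : nat -> nat -> nat -> nat) : Prop :=
  recursive (fun v : 3.-tuple nat =>
    f (tnth v ord0) (tnth v (inord 1)) (tnth v (inord 2))).

(** The step reads the counter, the previous value and the parameter. *)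
Fixpoint prim_rec (f : nat -> nat) (g : nat -> nat -> nat -> nat) (x a : nat) :=
  if x is y.+1 then g y (prim_rec f g y a) a else f a.

Lemma rec2_prim f g : rec1 f -> rec3 g -> rec2 (prim_rec f g).
Proof.
move=> hf hg; apply: (rec_prec hf hg) => [v|x v].
  by rewrite /= !(tnth_nth 0) /=.
by rewrite /= !(tnth_nth 0) /= !inordK.
Qed.

Lemma rec3_1 f : rec1 f -> rec3 (fun x _ _ => f x).
Proof. by move=> hf; apply: rec_app1 hf (rec_proj _). Qed.

Lemma rec3_2 f : rec1 f -> rec3 (fun _ y _ => f y).
Proof. by move=> hf; apply: rec_app1 hf (rec_proj _). Qed.

Lemma rec3_23 f : rec2 f -> rec3 (fun _ y z => f y z).
Proof. by move=> hf; apply: rec_app2 hf (rec_proj _) (rec_proj _). Qed.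

Lemma rec3_12 f : rec2 f -> rec3 (fun x y _ => f x y).
Proof. by move=> hf; apply: rec_app2 hf (rec_proj _) (rec_proj _). Qed.

Lemma rec2_swap f : rec2 f -> rec2 (fun x y => f y x).
Proof. by move=> hf; apply: rec_app2 hf (rec_proj _) (rec_proj _). Qed.

Lemma rec1_diag f c : rec2 f -> rec1 (fun x => f x c).
Proof. by move=> hf; apply: rec1_app2 hf rec1_id (rec1_const c). Qed.

Lemma rec2_add : rec2 addn.
Proof.
apply: rec2_ext (rec2_prim rec1_id (rec3_2 rec1_succ)) => x y.
by elim: x => //= x ->.
Qed.

Lemma rec1_pred : rec1 predn.
Proof.
have := rec1_diag 0 (rec2_prim (rec1_const 0) (rec3_1 rec1_id)).
by apply: rec1_ext => -[].
Qed.

Lemma rec2_sub : rec2 (fun x y => x - y).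
Proof.
apply: rec2_swap; apply: rec2_ext (rec2_prim rec1_id (rec3_2 rec1_pred)) => x y.
by elim: x => [|x IH] /=; [rewrite subn0 | rewrite IH subnS].
Qed.

Lemma rec2_mul : rec2 muln.
Proof.
apply: rec2_ext (rec2_prim (rec1_const 0) (rec3_23 rec2_add)) => x y.
by elim: x => //= x ->; rewrite mulSn addnC.
Qed.

Lemma rec1_double : rec1 double.
Proof.
by apply: rec1_ext (rec1_app2 rec2_add rec1_id rec1_id) => x; rewrite addnn.
Qed.

Lemma rec1_exp2 : rec1 (expn 2).
Proof.
have := rec1_diag 0 (rec2_prim (rec1_const 1) (rec3_2 rec1_double)).
by apply: rec1_ext; elim=> //= x ->; rewrite expnS mul2n.
Qed.

Lemma rec1_odd : rec1 (fun x => odd x).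
Proof.
have h := rec1_comp (f := subn 1) (rec1_app2 rec2_sub (rec1_const 1) rec1_id) rec1_id.
have := rec1_diag 0 (rec2_prim (rec1_const 0) (rec3_2 h)).
by apply: rec1_ext; elim=> //= x ->; case: (odd x).
Qed.

Lemma rec1_half : rec1 half.
Proof.
have := rec1_diag 0 (rec2_prim (rec1_const 0)
  (rec3_12 (rec2_app2 rec2_add (rec2_l rec1_odd) (rec2_r rec1_id)))).
by apply: rec1_ext; elim=> //= x ->; rewrite uphalf_half.
Qed.

(** ** Pairing *)

(** The head and tail of the sequence codes of [CodeSeq] are also a pairing
    function, so that pairs and sequences are taken apart in the same way. *)
Definition pairn (a b : nat) : nat := 2 ^ a * b.*2.+1.

Definition halves (k x : nat) : nat := iter k half x.

Definition exp_part (x : nat) : nat := logn 2 x.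
Definition odd_part (x : nat) : nat := halves (exp_part x).+1 x.

Lemma rec2_pairn : rec2 pairn.
Proof.
by apply: (rec2_app2 rec2_mul (rec2_l rec1_exp2)
  (rec2_r (rec1_comp rec1_succ rec1_double))).
Qed.

Lemma rec2_halves : rec2 halves.
Proof.
apply: rec2_ext (rec2_prim rec1_id (rec3_2 rec1_half)) => k x.
by elim: k => //= k ->.
Qed.

Lemma halves_pairn a b : halves a (pairn a b) = b.*2.+1.
Proof.
elim: a => [|a IH]; first by rewrite /pairn mul1n.
by rewrite /halves iterSr /pairn expnS -mulnA mul2n doubleK.
Qed.

Lemma exp_partK a b : exp_part (pairn a b) = a.
Proof.
rewrite /exp_part /pairn lognM ?expn_gt0 // pfactorK // lognE /=.
by rewrite dvdn2 /= odd_double /= addn0.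
Qed.

Lemma odd_partK a b : odd_part (pairn a b) = b.
Proof.
by rewrite /odd_part exp_partK /halves iterS -/(halves _ _) halves_pairn /= uphalf_double.
Qed.

Lemma pairn_onto x : 0 < x -> x = pairn (exp_part x) (odd_part x).
Proof.
move=> x0; have [k [m [odd_m ->]]] : exists k m, odd m /\ x = 2 ^ k * m.
  have [m cm ex] := @pfactor_coprime 2 x isT x0.
  by exists (logn 2 x), m; rewrite mulnC -ex -coprime2n.
have -> : 2 ^ k * m = pairn k m./2.
  by rewrite /pairn -[in LHS](odd_double_half m) odd_m.
by rewrite exp_partK odd_partK.
Qed.

(** The exponent is the least number of halvings that gives an odd number. *)
Lemma rec1_exp_part : rec1 exp_part.
Proof.
have sub1 f : rec2 f -> rec2 (fun y x => 1 - f y x).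
  by move=> hf; apply: rec2_app2 rec2_sub (rec2_const 1) hf.
have id2 : rec2 (fun _ x => x) := rec2_r rec1_id.
have rg : rec2 (fun y x => x * (1 - odd (halves y x))).
  by apply: rec2_app2 rec2_mul id2 (sub1 _ (rec2_app1 rec1_odd rec2_halves)).
suff key x : x * (1 - odd (halves (exp_part x) x)) = 0 /\
    forall y, y < exp_part x -> x * (1 - odd (halves y x)) <> 0.
  apply: (rec_mu rg) => v; have := key (tnth v ord0); rewrite !(tnth_nth 0) /=.
  by move=> [h1 h2]; split=> // y ya; rewrite !(tnth_nth 0) /=; exact: h2.
have [->|x0] := posnP x; first by rewrite /exp_part logn0.
have ex := pairn_onto x0; set a := exp_part x in ex *.
split=> [|y ya]; rewrite [in halves _ _]ex.
  by rewrite halves_pairn /= odd_double muln0.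
have -> : halves y (pairn a (odd_part x)) = (2 ^ (a - y.+1) * (odd_part x).*2.+1).*2.
  elim: y ya => [|y IH] ya.
    by rewrite /pairn /halves /= -[RHS]mul2n mulnA -expnS subn1 prednK.
  rewrite /halves iterS -/(halves _ _) IH ?(ltnW ya) // doubleK.
  rewrite -[RHS]mul2n mulnA -expnS; congr (2 ^ _ * _); lia.
by rewrite odd_double /= subn0 muln1; lia.
Qed.

Lemma rec1_odd_part : rec1 odd_part.
Proof.
exact: rec1_app2 rec2_halves (rec1_comp rec1_succ rec1_exp_part) rec1_id.
Qed.

(** * Computable functions on encoded data *)

Lemma pairn_gt0 a b : 0 < pairn a b.
Proof. by rewrite /pairn muln_gt0 expn_gt0. Qed.

Lemma pairn_inj a b a' b' : pairn a b = pairn a' b' -> a = a' /\ b = b'.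
Proof.
move=> e; split; first by rewrite -(exp_partK a b) e exp_partK.
by rewrite -(odd_partK a b) e odd_partK.
Qed.

(** Data are coded by numbers in the way in which instances of the problem are. *)
Class encoding (A : Type) := Encoding { enc : A -> nat; enc_inj : injective enc }.

#[export] Instance nat_encoding : encoding nat := Encoding (@inj_id nat).

Lemma nat_of_bool_inj : injective nat_of_bool. Proof. by case=> -[]. Qed.
#[export] Instance bool_encoding : encoding bool := Encoding nat_of_bool_inj.

Section Structures.
Context (A B : Type) (eA : encoding A) (eB : encoding B).

Lemma pair_code_inj : injective (fun x : A * B => pairn (enc x.1) (enc x.2)).
Proof.
by move=> [a b] [a' b'] /= /pairn_inj[e1 e2]; rewrite (enc_inj e1) (enc_inj e2).
Qed.

Lemma seq_code_inj : injective (fun s : seq A => CodeSeq.code (map enc s)).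
Proof. by apply: inj_comp (can_inj CodeSeq.codeK) _; exact: inj_map enc_inj. Qed.
End Structures.

#[export] Instance pair_encoding A B (eA : encoding A) (eB : encoding B) :
  encoding (A * B) := Encoding (@pair_code_inj A B eA eB).

#[export] Instance seq_encoding A (eA : encoding A) : encoding (seq A) :=
  Encoding (@seq_code_inj A eA).

Lemma enc_cons A (eA : encoding A) (x : A) s : enc (x :: s) = pairn (enc x) (enc s).
Proof. by []. Qed.

Definition computable A B {eA : encoding A} {eB : encoding B} (f : A -> B) : Prop :=
  exists2 g, rec1 g & forall x, g (enc x) = enc (f x).

Section Combinators.
Context {A B C : Type} {eA : encoding A} {eB : encoding B} {eC : encoding C}.

Lemma computable_ext (f g : A -> B) : f =1 g -> computable f -> computable g.
Proof. by move=> e [h rh he]; exists h => // x; rewrite he e. Qed.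

Lemma computable_id : computable (fun x : A => x).
Proof. by exists id => //; exact: rec1_id. Qed.

Lemma computable_const (b : B) : computable (fun _ : A => b).
Proof. by exists (fun _ => enc b) => //; exact: rec1_const. Qed.

Lemma computable_comp (f : B -> C) (g : A -> B) :
  computable f -> computable g -> computable (fun x => f (g x)).
Proof.
move=> [f' rf ef] [g' rg eg]; exists (f' \o g'); first exact: rec1_comp.
by move=> x; rewrite /= eg ef.
Qed.

Lemma computable_pair (f : A -> B) (g : A -> C) :
  computable f -> computable g -> computable (fun x => (f x, g x)).
Proof.
move=> [f' rf ef] [g' rg eg]; exists (fun x => pairn (f' x) (g' x)).
  exact: rec1_app2 rec2_pairn rf rg.
by move=> x; rewrite ef eg.
Qed.

Lemma computable_fst (f : A -> B * C) : computable f -> computable (fun x => (f x).1).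
Proof.
move=> [g rg eg]; exists (exp_part \o g); first exact: rec1_comp rec1_exp_part rg.
by move=> x; rewrite /= eg exp_partK.
Qed.

Lemma computable_snd (f : A -> B * C) : computable f -> computable (fun x => (f x).2).
Proof.
move=> [g rg eg]; exists (odd_part \o g); first exact: rec1_comp rec1_odd_part rg.
by move=> x; rewrite /= eg odd_partK.
Qed.

Lemma computable_cons (f : A -> B) (g : A -> seq B) :
  computable f -> computable g -> computable (fun x => f x :: g x).
Proof.
move=> [f' rf ef] [g' rg eg]; exists (fun x => pairn (f' x) (g' x)).
  exact: rec1_app2 rec2_pairn rf rg.
by move=> x; rewrite ef eg.
Qed.

Lemma rec1_cond c f g : rec1 c -> rec1 f -> rec1 g ->
  rec1 (fun x => if c x == 0 then g x else f x).
Proof.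
move=> rc rf rg; have one := rec1_const 1.
have r0 : rec1 (fun x => 1 - c x) := rec1_app2 rec2_sub one rc.
have r1 : rec1 (fun x => 1 - (1 - c x)) := rec1_app2 rec2_sub one r0.
have := rec1_app2 rec2_add (rec1_app2 rec2_mul r1 rf) (rec1_app2 rec2_mul r0 rg).
apply: rec1_ext => x; case: eqP => [->|]; first by rewrite mul0n mul1n.
by move=> /eqP; rewrite -lt0n => c0; have -> : 1 - c x = 0; lia.
Qed.

Lemma computable_if (b : A -> bool) (f g : A -> B) :
  computable b -> computable f -> computable g ->
  computable (fun x => if b x then f x else g x).
Proof.
move=> [b' rb eb] [f' rf ef] [g' rg eg].
exists (fun x => if b' x == 0 then g' x else f' x); first exact: rec1_cond.
by move=> x; rewrite eb ef eg; case: (b x).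
Qed.

(** The code of a nonempty sequence is the code of the pair of its head and
    tail, so it can be passed on as it is. *)
Lemma computable_match (l : A -> seq B) (f : A -> C) (g : A -> B -> seq B -> C) :
  computable l -> computable f ->
  computable (fun p : A * (B * seq B) => g p.1 p.2.1 p.2.2) ->
  computable (fun x => match l x with [::] => f x | b :: s => g x b s end).
Proof.
move=> [l' rl el] [f' rf ef] [g' rg eg].
exists (fun x => if l' x == 0 then f' x else g' (pairn x (l' x))).
  apply: rec1_cond => //.
  exact: rec1_comp rg (rec1_app2 rec2_pairn rec1_id rl).
move=> x; rewrite el ef; case: (l x) => [|b s] //.
by rewrite enc_cons (gtn_eqF (pairn_gt0 _ _)) -(eg (x, (b, s))).
Qed.

Lemma computable_nat_rec (n : A -> nat) (f : A -> B) (g : A -> nat -> B -> B) :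
  computable n -> computable f ->
  computable (fun p : A * (nat * B) => g p.1 p.2.1 p.2.2) ->
  computable (fun x => nat_rect (fun _ => B) (f x) (g x) (n x)).
Proof.
move=> [n' rn en] [f' rf ef] [g' rg eg].
have r3 : rec3 (fun y r a => g' (pairn a (pairn y r))).
  have p3 := rec_proj; apply: rec_app1 rg _; apply: rec_app2 rec2_pairn (rec_proj _) _.
  exact: rec_app2 rec2_pairn (rec_proj _) (rec_proj _).
exists (fun x => prim_rec f' (fun y r a => g' (pairn a (pairn y r))) (n' x) x).
  exact: rec1_app2 (rec2_prim rf r3) rn rec1_id.
by move=> x; rewrite en; elim: (n x) => //= k ->; rewrite -(eg (x, (k, _))).
Qed.

(** One step of a fold, on the code [r] of the pair of the accumulator and the
    remaining sequence; it is idle when the sequence is exhausted. *)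
Definition fold_step (h : nat -> nat) (a r : nat) : nat :=
  if odd_part r == 0 then r
  else pairn (h (pairn a (pairn (exp_part r) (exp_part (odd_part r)))))
             (odd_part (odd_part r)).

Lemma rec2_fold_step h : rec1 h -> rec2 (fold_step h).
Proof.
move=> rh; pose c := fun x => if odd_part (odd_part x) == 0 then odd_part x
  else pairn (h (pairn (exp_part x) (pairn (exp_part (odd_part x))
         (exp_part (odd_part (odd_part x)))))) (odd_part (odd_part (odd_part x))).
have ro := rec1_odd_part; have re := rec1_exp_part; have r2 := rec2_pairn.
have roo := rec1_comp ro ro.
have rc : rec1 c.
  apply: rec1_cond => //; apply: (rec1_app2 r2) (rec1_comp ro roo).
  apply: (rec1_comp rh); apply: (rec1_app2 r2 re).
  exact: rec1_app2 r2 (rec1_comp re ro) (rec1_comp re roo).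
apply: rec2_ext (rec2_app1 rc (rec2_app2 r2 (rec2_l rec1_id) (rec2_r rec1_id))).
by move=> a r; rewrite /c /fold_step !odd_partK !exp_partK.
Qed.

Lemma size_le_enc (s : seq B) : size s <= enc s.
Proof.
elim: s => // x s IH; rewrite enc_cons [size _]/=.
apply: leq_trans (_ : (enc s).*2.+1 <= _); first by lia.
by rewrite /pairn leq_pmull // expn_gt0.
Qed.

(** The code of a sequence bounds its length, so it is a sufficient number of
    steps. *)
Lemma computable_foldl (f : A -> C) (l : A -> seq B) (h : A -> C -> B -> C) :
  computable f -> computable l ->
  computable (fun p : A * (C * B) => h p.1 p.2.1 p.2.2) ->
  computable (fun x => foldl (h x) (f x) (l x)).
Proof.
move=> [f' rf ef] [l' rl el] [h' rh eh].
pose start x := pairn (f' x) (l' x).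
have rs : rec1 start := rec1_app2 rec2_pairn rf rl.
have r3 : rec3 (fun _ r a => fold_step h' a r).
  exact: rec3_23 (rec2_swap (rec2_fold_step rh)).
exists (fun x => exp_part (prim_rec start (fun _ r a => fold_step h' a r) (l' x) x)).
  exact: rec1_comp rec1_exp_part (rec1_app2 (rec2_prim rs r3) rl rec1_id).
move=> x; set loop := prim_rec _ _.
have loopE k : loop k (enc x) = pairn (enc (foldl (h x) (f x) (take k (l x))))
                                      (enc (drop k (l x))).
  elim: k => [|k IH]; first by rewrite /loop /= /start take0 drop0 ef el.
  rewrite -[loop k.+1 _]/(fold_step h' (enc x) (loop k (enc x))) IH.
  rewrite /fold_step odd_partK exp_partK; have [lk|kl] := leqP (size (l x)) k.
    rewrite (drop_oversize lk) (drop_oversize (leqW lk)) /=.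
    by rewrite (take_oversize lk) (take_oversize (leqW lk)).
  have b : B by case: (l x) kl.
  rewrite (drop_nth b kl) enc_cons (gtn_eqF (pairn_gt0 _ _)) exp_partK odd_partK.
  by rewrite (eh (x, (_, _))) (take_nth b kl) foldl_rcons.
by rewrite loopE exp_partK el take_oversize // size_le_enc.
Qed.

End Combinators.

(** ** A library of computable functions *)

Create HintDb computable.
Ltac comp := eauto 500 with computable nocore.

#[export] Hint Resolve computable_id computable_const computable_pair
  computable_fst computable_snd computable_cons computable_if : computable.

Lemma computable_app2 A B C D (eA : encoding A) (eB : encoding B) (eC : encoding C)
    (eD : encoding D) (f : B -> C -> D) (g : A -> B) (h : A -> C) :
  computable (fun p : B * C => f p.1 p.2) -> computable g -> computable h ->
  computable (fun x => f (g x) (h x)).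
Proof. by move=> cf cg ch; exact: computable_comp cf (computable_pair cg ch). Qed.

(** Comparison with the code of each element in turn finds the value in a table. *)
Lemma computable_finite (T : finType) B (eT : encoding T) (eB : encoding B)
  (f : T -> B) : computable f.
Proof.
suff [g rg eg] : exists2 g, rec1 g &
    forall x, x \in enum T -> g (@enc T eT x) = @enc B eB (f x).
  by exists g => // x; rewrite eg // mem_enum.
elim: (enum T) => [|a s [g rg eg]]; first by exists id => //; exact: rec1_id.
set e := @enc T eT a; pose c x := (x - e) + (e - x).
have rc : rec1 c.
  have ra := rec1_const e.
  exact: rec1_app2 rec2_add (rec1_app2 rec2_sub rec1_id ra) (rec1_app2 rec2_sub ra rec1_id).
exists (fun x => if c x == 0 then enc (f a) else g x).
  exact: rec1_cond rc rg (rec1_const _).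
move=> x; rewrite inE; have [->|xa] := eqVneq x a; first by rewrite /c subnn.
move=> /= xs; rewrite eg // ifN // /c.
by apply: contraNneq xa => h; apply/eqP/(@enc_inj T eT); rewrite -/e; lia.
Qed.

Section Library.
Context {A : Type} {eA : encoding A}.

Lemma computable_nat2 (f : nat -> nat -> nat) (g h : A -> nat) :
  rec2 f -> computable g -> computable h -> computable (fun x => f (g x) (h x)).
Proof.
move=> rf; apply: computable_app2.
exists (fun x => f (exp_part x) (odd_part x)).
  exact: rec1_app2 rf rec1_exp_part rec1_odd_part.
by move=> [x y]; rewrite exp_partK odd_partK.
Qed.

Lemma computable_nat1 (f : nat -> nat) (g : A -> nat) :
  rec1 f -> computable g -> computable (fun x => f (g x)).
Proof. by move=> rf cg; apply: computable_comp cg; exists f. Qed.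

Lemma computable_succ (f : A -> nat) : computable f -> computable (fun x => (f x).+1).
Proof. exact: computable_nat1 rec1_succ. Qed.

Lemma computable_pred (f : A -> nat) : computable f -> computable (fun x => (f x).-1).
Proof. exact: computable_nat1 rec1_pred. Qed.

Lemma computable_half (f : A -> nat) : computable f -> computable (fun x => (f x)./2).
Proof. exact: computable_nat1 rec1_half. Qed.

Lemma computable_odd (f : A -> nat) : computable f -> computable (fun x => odd (f x)).
Proof.
move=> cf; have [g rg eg] := computable_nat1 rec1_odd cf.
by exists g => // x; rewrite eg; case: (odd _).
Qed.

Lemma computable_add (f g : A -> nat) :
  computable f -> computable g -> computable (fun x => f x + g x).
Proof. exact: computable_nat2 rec2_add. Qed.

Lemma computable_mul (f g : A -> nat) :
  computable f -> computable g -> computable (fun x => f x * g x).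
Proof. exact: computable_nat2 rec2_mul. Qed.

Lemma computable_sub (f g : A -> nat) :
  computable f -> computable g -> computable (fun x => f x - g x).
Proof. exact: computable_nat2 rec2_sub. Qed.

Lemma computable_of_bool (f : A -> bool) :
  computable f -> computable (fun x => nat_of_bool (f x)).
Proof. by move=> [g rg eg]; exists g. Qed.

Lemma computable_is0 (f : A -> nat) : computable f -> computable (fun x => f x == 0).
Proof.
move=> cf; have [g rg eg] := computable_sub (computable_const 1) cf.
by exists g => // x; rewrite eg; case: (f x) => //= n; rewrite subSS sub0n.
Qed.

Lemma computable_leq (f g : A -> nat) :
  computable f -> computable g -> computable (fun x => f x <= g x).
Proof.
by move=> cf cg; rewrite /leq; apply: computable_is0; exact: computable_sub.
Qed.

Lemma computable_eq_nat (f g : A -> nat) :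
  computable f -> computable g -> computable (fun x => f x == g x).
Proof.
move=> cf cg.
have := computable_is0 (computable_add (computable_sub cf cg) (computable_sub cg cf)).
by apply: computable_ext => x; lia.
Qed.

Lemma computable_eq (T : eqType) (eT : encoding T) (f g : A -> T) :
  computable f -> computable g -> computable (fun x => f x == g x).
Proof.
move=> cf cg; have ce (h : A -> T) : @computable _ _ eA eT h ->
    @computable _ _ eA nat_encoding (fun x => @enc T eT (h x)).
  by move=> [k rk ek]; exists k.
have := computable_eq_nat (ce _ cf) (ce _ cg).
by apply: computable_ext => x; apply/eqP/eqP => [/(@enc_inj T eT)|->].
Qed.

Lemma computable_and (f g : A -> bool) :
  computable f -> computable g -> computable (fun x => f x && g x).
Proof. by move=> cf cg; rewrite /andb; comp. Qed.

Lemma computable_or (f g : A -> bool) :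
  computable f -> computable g -> computable (fun x => f x || g x).
Proof. by move=> cf cg; rewrite /orb; comp. Qed.

Lemma computable_neg (f : A -> bool) :
  computable f -> computable (fun x => ~~ f x).
Proof. by move=> cf; rewrite /negb; comp. Qed.

End Library.

#[export] Hint Resolve computable_succ computable_pred computable_half
  computable_odd computable_add computable_mul computable_sub computable_of_bool
  computable_leq computable_eq computable_and computable_or computable_neg
  : computable.

Section Iteration.
Context {A B : Type} {eA : encoding A} {eB : encoding B}.

Lemma computable_iter (n : A -> nat) (h : A -> B -> B) (f : A -> B) :
  computable n -> computable f -> computable (fun p : A * B => h p.1 p.2) ->
  computable (fun x => iter (n x) (h x) (f x)).
Proof.
move=> cn cf ch.
have ch' : computable (fun p : A * (nat * B) => h p.1 p.2.2).
  by apply: (computable_app2 ch); comp.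
have := computable_nat_rec (g := fun x _ => h x) cn cf ch'.
by apply: computable_ext => x; elim: (n x) => //= k ->.
Qed.

Lemma computable_rev (f : A -> seq B) :
  computable f -> computable (fun x => rev (f x)).
Proof.
move=> cf; apply: (computable_ext (f := fun x => foldl (fun s b => b :: s) [::] (f x))).
  by move=> x; elim/last_ind: (f x) => // s b IH; rewrite foldl_rcons IH rev_rcons.
apply: (computable_foldl (h := fun _ s b => b :: s)); comp.
Qed.
End Iteration.

Section FoldRight.
Context {A B C : Type} {eA : encoding A} {eB : encoding B} {eC : encoding C}.

Lemma computable_foldr (f : A -> C) (l : A -> seq B) (h : A -> B -> C -> C) :
  computable f -> computable l ->
  computable (fun p : A * (C * B) => h p.1 p.2.2 p.2.1) ->
  computable (fun x => foldr (h x) (f x) (l x)).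
Proof.
move=> cf cl ch.
apply: (computable_ext (f := fun x => foldl (fun c b => h x b c) (f x) (rev (l x)))).
  by move=> x; rewrite -foldl_rev.
by apply: (computable_foldl (h := fun x c b => h x b c)) => //; exact: computable_rev.
Qed.

End FoldRight.

Section Concatenation.
Context {A B : Type} {eA : encoding A} {eB : encoding B}.

Lemma computable_cat (f g : A -> seq B) :
  computable f -> computable g -> computable (fun x => f x ++ g x).
Proof.
move=> cf cg; apply: (computable_ext (f := fun x => foldr cons (g x) (f x))).
  by move=> x; elim: (f x) => //= b s ->.
apply: (computable_foldr (h := fun _ => cons)) => //; comp.
Qed.

End Concatenation.

Section Lists.
Context {A B : Type} {eA : encoding A} {eB : encoding B}.

Lemma computable_flatten (f : A -> seq (seq B)) :
  computable f -> computable (fun x => flatten (f x)).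
Proof.
move=> cf; apply: (computable_foldr (h := fun _ => cat)) => //; first by comp.
by apply: computable_cat; comp.
Qed.

Lemma computable_size (f : A -> seq B) :
  computable f -> computable (fun x => size (f x)).
Proof.
move=> cf; apply: (computable_ext (f := fun x => foldr (fun _ k => k.+1) 0 (f x))).
  by move=> x; elim: (f x) => //= b s ->.
by apply: (computable_foldr (h := fun _ _ k => k.+1)) => //; comp.
Qed.

Lemma computable_head b (f : A -> seq B) :
  computable f -> computable (fun x => head b (f x)).
Proof. by move=> cf; apply: (computable_match (g := fun _ c _ => c)) => //; comp. Qed.

Lemma computable_last b (f : A -> seq B) :
  computable f -> computable (fun x => last b (f x)).
Proof.
move=> cf; apply: (computable_ext (f := fun x => foldl (fun _ c => c) b (f x))).
  by move=> x; elim: (f x) b => //= c s IH b; rewrite IH.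
by apply: (computable_foldl (h := fun _ _ c => c)) => //; comp.
Qed.

Lemma computable_nilp (f : A -> seq B) :
  computable f -> computable (fun x => nilp (f x)).
Proof. by move=> cf; apply: computable_is0; exact: computable_size. Qed.
End Lists.

#[export] Hint Resolve computable_rev computable_cat computable_flatten
  computable_size computable_head computable_last computable_nilp : computable.

Section Maps.
Context {A B C : Type} {eA : encoding A} {eB : encoding B} {eC : encoding C}.

Lemma computable_map (l : A -> seq B) (h : A -> B -> C) :
  computable l -> computable (fun p : A * B => h p.1 p.2) ->
  computable (fun x => map (h x) (l x)).
Proof.
move=> cl ch; apply: (computable_foldr (h := fun x b s => h x b :: s)) => //.
  by comp.
apply: computable_cons; last by comp.
by apply: (computable_app2 ch); comp.
Qed.

Lemma computable_has (l : A -> seq B) (h : A -> B -> bool) :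
  computable l -> computable (fun p : A * B => h p.1 p.2) ->
  computable (fun x => has (h x) (l x)).
Proof.
move=> cl ch.
apply: (computable_ext (f := fun x => foldr (fun b e => h x b || e) false (l x))).
  by move=> x; elim: (l x) => //= b s ->.
apply: (computable_foldr (h := fun x b e => h x b || e)) => //; first by comp.
apply: computable_or; last by comp.
by apply: (computable_app2 ch); comp.
Qed.

Lemma computable_all (l : A -> seq B) (h : A -> B -> bool) :
  computable l -> computable (fun p : A * B => h p.1 p.2) ->
  computable (fun x => all (h x) (l x)).
Proof.
move=> cl ch.
apply: (computable_ext (f := fun x => foldr (fun b e => h x b && e) true (l x))).
  by move=> x; elim: (l x) => //= b s ->.
apply: (computable_foldr (h := fun x b e => h x b && e)) => //; first by comp.
apply: computable_and; last by comp.
by apply: (computable_app2 ch); comp.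
Qed.

Lemma computable_iota0 (n : A -> nat) :
  computable n -> computable (fun x => iota 0 (n x)).
Proof.
move=> cn; apply: (computable_ext
  (f := fun x => nat_rect (fun _ => seq nat) [::] (fun k s => s ++ [:: k]) (n x))).
  by move=> x; elim: (n x) => //= k ->; rewrite -[RHS]/(iota 0 k.+1) -addn1 iotaD.
by apply: (computable_nat_rec (g := fun _ k s => s ++ [:: k])) => //; comp.
Qed.

Lemma computable_exp c (n : A -> nat) :
  computable n -> computable (fun x => c ^ n x).
Proof.
move=> cn; apply: (computable_ext (f := fun x => iter (n x) (muln c) 1)).
  by move=> x; elim: (n x) => //= k ->; rewrite expnS.
by apply: (computable_iter (h := fun _ => muln c)) => //; comp.
Qed.
End Maps.

#[export] Hint Resolve computable_iota0 computable_exp : computable.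

(** ** The decision procedure is computable *)

Lemma enum_rank_code_inj (T : finType) : injective (fun x : T => nat_of_ord (enum_rank x)).
Proof. exact: inj_comp val_inj enum_rank_inj. Qed.

#[export] Instance ffun_encoding :
  encoding {ffun option bool * option bool -> bool} :=
  Encoding (@enum_rank_code_inj {ffun option bool * option bool -> bool}).

Lemma computable_inv_letter A (eA : encoding A) (f : A -> sletter) :
  computable f -> computable (fun x => inv_letter (f x)).
Proof. by move=> cf; rewrite /inv_letter; comp. Qed.
#[export] Hint Resolve computable_inv_letter : computable.

Lemma computable_push : computable (fun p : sletter * sword => push p.1 p.2).
Proof.
rewrite /push; apply: (computable_match
  (g := fun p y r => if y == inv_letter p.1 then r else p.1 :: p.2)); comp.
Qed.

Lemma computable_red A (eA : encoding A) (f : A -> sword) :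
  computable f -> computable (fun x => red (f x)).
Proof.
move=> cf; apply: (computable_foldr (h := fun _ => push)) => //; first by comp.
by apply: (computable_app2 computable_push); comp.
Qed.

Lemma computable_inv_word A (eA : encoding A) (f : A -> sword) :
  computable f -> computable (fun x => inv_word (f x)).
Proof.
move=> cf; rewrite /inv_word; apply: computable_rev.
by apply: (computable_map (h := fun _ => inv_letter)) => //; comp.
Qed.
#[export] Hint Resolve computable_red computable_inv_word : computable.

Lemma computable_act_letter :
  computable (fun p : sletter * sletter => act_letter p.1 p.2).
Proof.
apply: (computable_ext (f := fun p : sletter * sletter =>
  if p.2.1 == p.1.1 then
    if p.1.2 then [:: (p.1.1.+1, p.2.2)]
    else [:: (p.1.1, true); (p.1.1.+1, p.2.2); (p.1.1, false)]
  else if p.2.1 == p.1.1.+1 then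
    if p.1.2 then [:: (p.1.1.+1, false); (p.1.1, p.2.2); (p.1.1.+1, true)]
    else [:: (p.1.1, p.2.2)]
  else [:: p.2])); first by case=> [[k e] [i d]].
by comp.
Qed.

Lemma computable_act_word :
  computable (fun p : sletter * sword => act_word p.1 p.2).
Proof.
rewrite /act_word /extend; apply: computable_flatten.
by apply: (computable_map (h := fun p => act_letter p.1)); [comp |];
  apply: (computable_app2 computable_act_letter); comp.
Qed.

Lemma computable_act A (eA : encoding A) (f g : A -> sword) :
  computable f -> computable g -> computable (fun x => act (f x) (g x)).
Proof.
move=> cf cg; apply: (computable_foldr (h := fun _ => act_word)) => //.
by apply: (computable_app2 computable_act_word); comp.
Qed.
#[export] Hint Resolve computable_act : computable.

Lemma computable_comb_step :
  computable (fun p : comb_state * sletter => comb_step p.1 p.2).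
Proof.
apply: (computable_ext (f := fun p : comb_state * sletter =>
  let f := p.1.1.1 in let b := p.1.1.2 in let j := p.1.2 in
  let i := p.2.1 in let e := p.2.2 in
  if i == j then (if e then f ++ act b [:: (j, true)] else f, b, j.+1)
  else if i.+1 == j then (if e then f else f ++ act b [:: (i, false)], b, i)
  else (f, b ++ [:: (if j < i then i.-1 else i, e)], j))).
  by case=> [[[f b] j] [i e]].
by rewrite /=; comp.
Qed.

Lemma computable_comb A (eA : encoding A) m (f : A -> sword) :
  computable f -> computable (fun x => comb ([::], [::], m) (f x)).
Proof.
move=> cf; apply: (computable_foldl (h := fun _ => comb_step)) => //; first by comp.
by apply: (computable_app2 computable_comb_step); comp.
Qed.
#[export] Hint Resolve computable_comb : computable.

Lemma computable_trivialb A (eA : encoding A) m (f : A -> sword) :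
  computable f -> computable (fun x => trivialb m (f x)).
Proof.
move=> cf; enough (h : computable (trivialb m)) by exact: computable_comp h cf.
elim: m {f cf} => [|m IH]; first by comp.
apply: (computable_ext (f := fun w : sword => let st := comb ([::], [::], m.+1) w in
  [&& st.2 == m.+1, red st.1.1 == [::] & trivialb m st.1.2])).
  by move=> w /=; case: (comb _ w) => [[f b] j].
rewrite /=; apply: computable_and; first by comp.
apply: computable_and; first by comp.
by apply: (computable_comp IH); comp.
Qed.
#[export] Hint Resolve computable_trivialb : computable.

Lemma computable_braid_eq_test A (eA : encoding A) m (f g : A -> sword) :
  computable f -> computable g -> computable (fun x => braid_eq_test m (f x) (g x)).
Proof. by move=> cf cg; rewrite /braid_eq_test; comp. Qed.

Lemma computable_child A (eA : encoding A) (rho : A -> rule) (f g : A -> profile) :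
  computable rho -> computable f -> computable g ->
  computable (fun x => child (rho x) (f x) (g x)).
Proof.
move=> cr cf cg.
assert (h : computable (fun p : rule * profile * profile => child p.1.1 p.1.2 p.2)).
  exact: computable_finite.
by apply: (computable_comp h (computable_pair (computable_pair cr cf) cg)).
Qed.
#[export] Hint Resolve computable_braid_eq_test computable_child : computable.

Lemma computable_children A (eA : encoding A) (rho : A -> rule) (r : A -> row) :
  computable rho -> computable r ->
  computable (fun x => children_from (rho x) empty_profile (r x)).
Proof.
move=> cr cf.
pose f x st b := (b, st.2 ++ [:: child (rho x) st.1 b]) : profile * row.
apply: (computable_ext (f := fun x =>
  (foldl (f x) (empty_profile, [::]) (r x)).2 ++
  [:: child (rho x) (foldl (f x) (empty_profile, [::]) (r x)).1 empty_profile])).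
  move=> x; suff h a u s : (foldl (f x) (a, u) s).2 ++
      [:: child (rho x) (foldl (f x) (a, u) s).1 empty_profile] =
      u ++ children_from (rho x) a s by rewrite h.
  by elim: s a u => //= b s IH a u; rewrite IH -catA.
assert (cl : computable (fun x => foldl (f x) (empty_profile, [::]) (r x))).
  assert (cr1 : computable (fun p : A * (profile * row * profile) => rho p.1)).
    by apply: (computable_comp cr); comp.
  by apply: computable_foldl => //; rewrite /f /=; comp.
by comp.
Qed.

Lemma computable_trim_end A (eA : encoding A) (r : A -> row) :
  computable r -> computable (fun x => trim_end (r x)).
Proof.
move=> cr; apply: (computable_foldr
  (h := fun _ s r => if (s == empty_profile) && nilp r then [::] else s :: r)) => //.
  by comp.
by comp.
Qed.
#[export] Hint Resolve computable_children computable_trim_end : computable.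

Lemma computable_step_row A (eA : encoding A) (rho : A -> rule) (r : A -> row) :
  computable rho -> computable r -> computable (fun x => step (rho x) (r x)).
Proof. by move=> cr cf; rewrite /step /trim; comp. Qed.

Lemma computable_profile_map A (eA : encoding A) B (eB : encoding B)
    (h : profile -> B) (f : A -> profile) :
  computable f -> computable (fun x => h (f x)).
Proof.
move=> cf; assert (ch : computable h) by exact: computable_finite.
exact: computable_comp ch cf.
Qed.

Lemma computable_row_scan A (eA : encoding A) (r : A -> row) :
  computable r -> computable (fun x => row_scan (r x)).
Proof.
move=> cr; apply: (computable_foldl (h := fun _ => emit)) => //; first by comp.
rewrite /emit; apply: computable_pair.
  apply: computable_add; [by comp | by apply: computable_profile_map; comp].
apply: computable_cat; first by comp.
apply: (computable_ext (f := fun p : A * (nat * sword * profile) =>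
  let s := p.2.2 in
  if [&& s.1.1.1, s.1.1.2 & s.1.2] then [:: (p.2.1.1, s.2)] else [::])).
  by move=> [x [st [[[l r'] t] k]]].
by rewrite /=; comp.
Qed.
#[export] Hint Resolve computable_step_row computable_row_scan : computable.

Lemma computable_valid_row A (eA : encoding A) n (w : A -> nat) (r : A -> row) :
  computable w -> computable r -> computable (fun x => valid_row n (w x) (r x)).
Proof.
move=> cw cr; rewrite /valid_row /tight.
apply: computable_and; last by comp.
apply: (computable_all (h := fun _ => proper_profile)) => //.
by apply: computable_profile_map; comp.
Qed.
#[export] Hint Resolve computable_valid_row : computable.

Section Orbit.
Context {A : Type} {eA : encoding A}.
Variables (rho : A -> rule) (r : A -> row) (w len : A -> nat).
Hypotheses (crho : computable rho) (cr : computable r)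
  (cw : computable w) (clen : computable len).

Let c1 B (eB : encoding B) (f : A -> B) :
  computable f -> computable (fun p : A * nat => f p.1).
Proof. by move=> cf; apply: (computable_comp cf); comp. Qed.

Lemma computable_orbit :
  computable (fun p : A * nat => iter p.2 (step (rho p.1)) (r p.1)).
Proof.
apply: (computable_iter (h := fun p => step (rho p.1))); [by comp|exact: c1|].
apply: computable_step_row; last by comp.
by apply: (computable_comp crho); comp.
Qed.

Lemma computable_orbit_valid n :
  computable (fun x => orbit_valid n (w x) (rho x) (r x) (len x)).
Proof.
apply: (computable_all (h := fun x i => valid_row n (w x) (iter i (step (rho x)) (r x)))).
  by comp.
by apply: computable_valid_row; [exact: c1|exact: computable_orbit].
Qed.

Lemma computable_orbit_word :
  computable (fun x => orbit_word (rho x) (r x) (len x)).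
Proof.
apply: computable_flatten.
apply: (computable_map (h := fun x i => (row_scan (iter i (step (rho x)) (r x))).2)).
  by comp.
by apply: computable_snd; apply: computable_row_scan; exact: computable_orbit.
Qed.
End Orbit.
#[export] Hint Resolve computable_orbit_valid computable_orbit_word : computable.

Lemma computable_all_rows A (eA : encoding A) (w : A -> nat) :
  computable w -> computable (fun x => all_rows (w x)).
Proof.
move=> cw; apply: (computable_ext (f := fun x => iter (w x) (fun rs : seq row =>
   [::] :: flatten (map (fun s => map (cons s) rs) (enum {: profile}))) [:: [::]])).
  by move=> x; elim: (w x) => //= k ->.
apply: (computable_iter (h := fun _ (rs : seq row) => [::] ::
  flatten (map (fun s => map (cons s) rs) (enum {: profile})))) => //; first by comp.
apply: computable_cons; first by comp.
apply: computable_flatten.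
apply: (computable_map (h := fun (p : A * seq row) s => map (cons s) p.2)); first by comp.
by apply: (computable_map (h := fun p => cons p.2)); comp.
Qed.

Lemma computable_exponent_bound A (eA : encoding A) m (l : A -> nat) :
  computable l -> computable (fun x => exponent_bound m (l x)).
Proof.
move=> cl; enough (h : computable (exponent_bound m)) by exact: computable_comp h cl.
elim: m {l cl} => [|m IH]; first exact: computable_const.
rewrite /=; apply: computable_mul; first by comp.
apply: computable_add; last by comp.
apply: computable_add; last by comp.
by apply: (computable_comp IH); comp.
Qed.
#[export] Hint Resolve computable_all_rows computable_exponent_bound : computable.

Lemma computable_length_bound A (eA : encoding A) m (f g h : A -> nat) :
  computable f -> computable g -> computable h ->
  computable (fun x => length_bound m (f x) (g x) (h x)).
Proof. by move=> cf cg ch; rewrite /length_bound; comp. Qed.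
#[export] Hint Resolve computable_length_bound : computable.

Lemma computable_search A (eA : encoding A) n (c : A -> sword) (w : A -> nat) :
  computable c -> computable w -> computable (fun x => search n (c x) (w x)).
Proof.
move=> cc cw.
apply: (computable_has (h := fun x rho => has (fun r => has (fun len =>
      orbit_valid n (w x) rho r len && braid_eq_test n.-1 (orbit_word rho r len) (c x))
    (iota 0 (length_bound n.-1 (size (all_rows (w x))) (w x) (size (c x))).+1))
    (all_rows (w x)))); first exact: computable_const.
apply: (computable_has (h := fun p r => has (fun len =>
      orbit_valid n (w p.1) p.2 r len &&
      braid_eq_test n.-1 (orbit_word p.2 r len) (c p.1))
    (iota 0 (length_bound n.-1 (size (all_rows (w p.1))) (w p.1) (size (c p.1))).+1))).
  by apply: computable_all_rows; apply: computable_comp cw _; comp.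
assert (cw1 : computable (fun p : A * rule * row => w p.1.1)).
  by apply: (computable_comp cw); comp.
assert (cc1 : computable (fun p : A * rule * row => c p.1.1)).
  by apply: (computable_comp cc); comp.
apply: (computable_has (h := fun p len =>
      orbit_valid n (w p.1.1) p.1.2 p.2 len &&
      braid_eq_test n.-1 (orbit_word p.1.2 p.2 len) (c p.1.1))); first by comp.
apply: computable_and.
  apply: computable_orbit_valid; try by comp.
  by apply: (computable_comp cw); comp.
apply: computable_braid_eq_test; first by comp.
by apply: (computable_comp cc); comp.
Qed.

Theorem theorem3p10 (n : nat) (n_gt0 : 0 < n) :
  recursively_decidable (@instance_code n)
    (fun x : word n * nat =>
       exists p : pattern n,
         SCA_representation (braid_class x.1) p /\ width_at_most x.2 p).
Proof.
assert (cs : computable (fun p : seq nat * nat =>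
    search n (map (fun k => (k./2, odd k)) p.1) p.2)).
  apply: computable_search; last by comp.
  by apply: (computable_map (h := fun _ k => (k./2, odd k))); comp.
have [g rg eg] := cs.
exists (fun v => g (pairn (tnth v ord0) (tnth v (lift ord0 ord0)))).
  exact: rec_app1 rg rec2_pairn.
move=> [b w]; rewrite !(tnth_nth 0) /= /word_code.
have := eg (map (@letter_code n) b, w); rewrite /= map_id => ->.
have -> : [seq (k./2, odd k) | k <- map (@letter_code n) b] = raw b.
  (* The code of a letter [(i, e)] is [2 i + e]. *)
  rewrite -map_comp; apply: eq_map => -[i e]; rewrite /letter_code /raw_letter /=.
  by congr (_, _); case: e; lia.
by case: searchP => h; split.
Qed.
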